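(* Let $G$ be a graph that does not contain a cycle with a unique chord. Then either $\chi(G)=\omega(G)$ or $\chi(G)\le 3$. In particular, $\chi(G)\le\omega(G)+1$.
   Context: All graphs are finite and simple. A cycle in $G$ is a sequence of nodes $v_1v_2\ldots v_kv_1$ ($k\ge3$), distinct except for the first and last, with consecutive nodes adjacent; an edge of $G$ with both ends in the cycle that is not an edge of the cycle is a chord. $G$ does not contain a cycle with a unique chord if no cycle of $G$ has exactly one chord. $\chi(G)$ is the chromatic number and $\omega(G)$ the size of a maximum clique of $G$. *)

(* Defs.v *)
From mathcomp Require Import all_boot.

Set Implicit Arguments.
Unset Strict Implicit.
Unset Printing Implicit Defensive.

Record sgraph := SGraph {
  vertex :> finType;
  adj : rel vertex;
  adj_sym : symmetric adj;
  adj_irrefl : irreflexive adj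
}.

Section Invariants.

Variable G : sgraph.

(* The list c = [:: v1; ...; vk] stands for the cycle v1 v2 ... vk v1. *)
Definition is_cycle (c : seq G) : bool := (3 <= size c) && ucycleb (@adj G) c.

Definition cycle_edge (c : seq G) (x y : G) : bool :=
  [&& x \in c, y \in c & (next c x == y) || (next c y == x)].

(* Chords are unordered pairs, so that each one is counted once. *)
Definition chords (c : seq G) : {set {set G}} :=
  [set [set p.1; p.2] | p : G * G &
     [&& p.1 \in c, p.2 \in c, adj p.1 p.2 & ~~ cycle_edge c p.1 p.2]].

Definition unique_chord_free : Prop :=
  forall c : seq G, is_cycle c -> #|chords c| <> 1.

Definition clique (K : {set G}) : bool :=
  [forall x in K, forall y in K, (x != y) ==> adj x y].

Definition omega : nat := \max_(K : {set G} | clique K) #|K|.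

Definition colorable (k : nat) : bool :=
  [exists f : {ffun G -> 'I_k}, [forall x, forall y, adj x y ==> (f x != f y)]].

Lemma ex_colorable : exists k, colorable k.
Proof.
exists #|G|; apply/existsP; exists [ffun x => enum_rank x].
apply/'forall_forallP => x y; apply/implyP => xy; rewrite !ffunE.
by apply/eqP => /enum_rank_inj exy; rewrite exy adj_irrefl in xy.
Qed.

Definition chi : nat := ex_minn ex_colorable.

End Invariants.

(* Main.v *)
Require Import Defs.
From mathcomp Require Import all_boot perm.

(**
If [K] is a maximal clique with at least three vertices, then every component
of the rest of the graph has at most one neighbour in [K]; otherwise a shortest
path through the component closes up with a triangle of [K] into a cycle with a
unique chord.  So one can colour by gluing at cut vertices, and it remains to
3-colour triangle-free graphs.

For the latter one proves a stronger claim by induction on [D]: if [W] and [D]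
are disjoint connected sets with no edge between them and [S] is the set of
their common neighbours, then [D] has a 3-colouring extending a constant
colouring of [S].  The set [S] is stable.  Let [T] be the set of vertices of [D]
with a neighbour in [S], and give each edge of [D] the sign [-] if both its ends
are in [T] and [+] otherwise.  If this signed graph is balanced, colour [T] with
the two remaining colours according to the balancing: on the neighbourhood of
each component of [D \ T] the colour is constant, so the induction hypothesis
applies to that component and [W ∪ S].

If it is not balanced, there is an induced cycle [q] of [D] with an odd number
of negative edges.  Any two vertices of [S] are joined by a path through [W],
and the absence of cycles with a unique chord forces the neighbourhoods on [q]
of vertices of [S] to be blocks of size one or two partitioning [q ∩ T].
Exchanging the two elements of each block maps negative edges of [q] to negative
edges and fixes none of them, so their number is even.
*)

Set Implicit Arguments.
Unset Strict Implicit.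
Unset Printing Implicit Defensive.

(** * Two induced paths with three edges between them *)

Lemma mem2_split (T : eqType) (c : seq T) (x y : T) :
    x \in c -> y \in c -> x != y ->
  exists p1 p2 p3, c = p1 ++ x :: p2 ++ y :: p3 \/ c = p1 ++ y :: p2 ++ x :: p3.
Proof.
move=> xc; case/splitPr: xc => p1 p2; rewrite mem_cat in_cons => /or3P[yp|/eqP->|yp].
- by case/splitPr: yp => q1 q2 _; exists q1, q2, p2; right; rewrite -catA.
- by rewrite eqxx.
- by case/splitPr: yp => q1 q2 _; exists p1, q1, q2; left.
Qed.

Lemma next_head (T : eqType) (x y : T) (p : seq T) : next (x :: y :: p) x = y.
Proof. by rewrite /= eqxx. Qed.

Section Graph.

Variable G : sgraph.
Implicit Types (x y z s : G) (p q A B C : seq G).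

Lemma cycle_edge_rot n p x y :
  uniq p -> cycle_edge (rot n p) x y = cycle_edge p x y.
Proof. by move=> Up; rewrite /cycle_edge !mem_rot !next_rot. Qed.

Lemma cycle_edgeC p x y : cycle_edge p x y = cycle_edge p y x.
Proof. by rewrite /cycle_edge andbCA orbC. Qed.

(** Rotate the cycle to start at [x]: the successor of [x] is [y] exactly when [B] is empty, and the
    successor of [y] is [x] exactly when [C ++ A] is. *)
Lemma cycle_edge_split A x B y C : uniq (A ++ x :: B ++ y :: C) ->
  cycle_edge (A ++ x :: B ++ y :: C) x y = nilp B || nilp C && nilp A.
Proof.
move=> U; rewrite -(cycle_edge_rot (size A)) // rot_size_cat.
move: U; rewrite uniq_catC => U.
have Er : (x :: B ++ y :: C) ++ A = (x :: B) ++ y :: C ++ A by rewrite /= -catA.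
have Uy : uniq (y :: (C ++ A) ++ x :: B) by rewrite -cat_cons uniq_catC -Er.
have Ey : next ((x :: B ++ y :: C) ++ A) y = next (y :: (C ++ A) ++ x :: B) y.
  by rewrite -(next_rot (size (x :: B)) U) Er rot_size_cat.
rewrite /cycle_edge Ey !mem_cat !in_cons !mem_cat !in_cons !eqxx !orbT !andTb.
congr orb.
  case: B U {Er Uy Ey} => [|z B]; first by rewrite next_head eqxx.
  rewrite next_head; case: eqP => // ->.
  by rewrite /= !mem_cat mem_head !orbT /= andbF.
rewrite -cat_nilp.
case: (C ++ A) Uy {Er Ey} => [|z D] Uy; first by rewrite next_head eqxx.
rewrite next_head; case: eqP Uy => // ->.
by rewrite [uniq _]/= mem_cat mem_head !orbT !andbF.
Qed.

(** Chordlessness is phrased by decompositions of the list, without indices, so that it applies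
    directly after splitting at two vertices; symmetry of [adj] covers the other order. *)
Definition induced_path p :=
  [/\ uniq p, sorted (@adj G) p &
      forall A x B y C, p = A ++ x :: B ++ y :: C -> adj x y -> B = [::]].

(** In a cycle made of two induced paths, this leaves only edges between the two paths as possible
    chords. *)
Lemma induced_path_adj p x y A B : uniq (A ++ p ++ B) -> induced_path p ->
  x \in p -> y \in p -> adj x y -> cycle_edge (A ++ p ++ B) x y.
Proof.
move=> U [Up _ Hp] xp yp xy.
have nxy : x != y by apply: contraTneq xy => ->; rewrite adj_irrefl.
have [p1 [p2 [p3 E]]] := mem2_split xp yp nxy.
wlog : x y xy nxy xp yp E / p = p1 ++ x :: p2 ++ y :: p3.
  move=> H; case: E => E; first by apply: H => //; left.
  by rewrite cycle_edgeC; apply: H; rewrite 1?adj_sym 1?eq_sym //; left.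
move=> {}E; rewrite E (Hp _ _ _ _ _ E xy) in U *.
have EE : A ++ (p1 ++ x :: [::] ++ y :: p3) ++ B
          = (A ++ p1) ++ x :: [::] ++ y :: (p3 ++ B) by rewrite /= -!catA.
by rewrite EE cycle_edge_split // -EE.
Qed.

Lemma induced_path_rev p : induced_path p -> induced_path (rev p).
Proof.
case=> U S H; split; first by rewrite rev_uniq.
  by rewrite rev_sorted (eq_sorted (e' := @adj G)) // => x y; rewrite adj_sym.
move=> A x B y C E; rewrite adj_sym => xy.
have /H/(_ xy) : p = rev C ++ y :: rev B ++ x :: rev A.
  by rewrite -[p]revK E !(rev_cat, rev_cons) -!cats1 -!catA.
by move/(congr1 rev); rewrite revK.
Qed.

Lemma induced_path1 x : induced_path [:: x].
Proof. by split=> // -[|? []] // ? [|? ?] //. Qed.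

Lemma induced_path_cons x y p : x \notin y :: p -> adj x y ->
  {in p, forall z, ~~ adj x z} -> induced_path (y :: p) -> induced_path (x :: y :: p).
Proof.
move=> xp xy xN [U S H]; split; [by rewrite cons_uniq xp | by rewrite /= xy |].
case=> [|a A] u B v C []; last by move=> _; apply: H.
move=> <-; case: B => [|b B] [_ E] // /(negP (xN _ _)) [].
by rewrite E mem_cat mem_head orbT.
Qed.

Lemma induced_path_rcons x p y : y \notin x :: p -> adj y (last x p) ->
  {in belast x p, forall z, ~~ adj y z} ->
  induced_path (x :: p) -> induced_path (x :: rcons p y).
Proof.
move=> yp yx yN H; rewrite -rcons_cons -[rcons _ _]revK; apply: induced_path_rev.
move: yp yN (induced_path_rev H); rewrite lastI !rev_rcons => yp yN Hr.
apply: induced_path_cons => //; last by move=> z; rewrite mem_rev; apply: yN.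
by move: yp; rewrite !inE mem_rev mem_rcons inE.
Qed.

Definition cut_edges A B := \sum_(x <- A) count (@adj G x) B.

Lemma size_cut_edges A B :
  size [seq u <- [seq (x, y) | x <- A, y <- B] | @adj G u.1 u.2] = cut_edges A B.
Proof.
rewrite size_filter count_flatten -map_comp sumnE big_map /cut_edges.
by apply: eq_bigr => x _ /=; rewrite count_map; apply: eq_count.
Qed.

Hypothesis hG : unique_chord_free G.

(** The two paths form a cycle. Two of the three edges between them close it, and the third is its
    only chord because the paths are induced. *)
Lemma closed_two_paths a A b B :
    induced_path (a :: A) -> induced_path (b :: B) ->
    {in a :: A, forall x, x \notin b :: B} ->
    adj (last a A) b -> adj (last b B) a -> cut_edges (a :: A) (b :: B) = 3 -> False.
Proof.
move=> IA IB AB ab ba; rewrite -size_cut_edges.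
have [UA SA _] := IA; have [UB SB _] := IB.
set F := filter _ _ => sF.
have UF : uniq F.
  by rewrite filter_uniq // allpairs_uniq // => -[? ?] [? ?] _ _ [-> ->].
have inF x y : ((x, y) \in F) = [&& adj x y, x \in a :: A & y \in b :: B].
  rewrite mem_filter; congr andb; apply/allpairsP/andP => [[[u v] [uA vB [-> ->]]]|[? ?]] //.
  by exists (x, y).
have aF : (last a A, b) \in F by rewrite inF ab mem_last mem_head.
have bF : (a, last b B) \in F by rewrite inF adj_sym ba mem_last mem_head.
have Uc : uniq ((a :: A) ++ b :: B).
  by rewrite cat_uniq UA UB andbT; apply/hasPn => x; apply: contraL; apply: AB.
(* If the closing edges coincided, both paths would be single vertices, with at most one edge
   between them. *)
have dif : (last a A, b) != (a, last b B).
  apply/eqP => -[E1 E2].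
  have nilL (z : G) p : uniq (z :: p) -> last z p = z -> p = [::].
    by case: p => //= y p /andP[/negP zp _] E; case: zp; rewrite -{1}E mem_last.
  have EA := nilL _ _ UA E1; have EB := nilL _ _ UB (esym E2).
  have := size_filter (fun u : G * G => adj u.1 u.2) [seq (x, y) | x <- a :: A, y <- b :: B].
  by rewrite -/F sF EA EB /=; case: (adj a b).
have {bF aF dif}[[x y] [Fw [w1 w2]]] : exists w, F =i [:: (last a A, b); (a, last b B); w] /\
     w != (last a A, b) /\ w != (a, last b B).
  set F1 := rem (last a A, b) F; set F2 := rem (a, last b B) F1.
  have UF1 : uniq F1 by apply: rem_uniq.
  have bF1 : (a, last b B) \in F1 by rewrite mem_rem_uniq // !inE eq_sym dif.
  have : size F2 = 1 by rewrite !size_rem // sF.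
  case E: F2 => [|w []] // _; exists w.
  have wF2 u : (u == w) = [&& u != (a, last b B), u != (last a A, b) & u \in F].
    have := mem_rem_uniq (a, last b B) UF1 u; rewrite -/F2 E !inE => ->.
    by rewrite mem_rem_uniq // !inE.
  have := wF2 w; rewrite eqxx => /esym/and3P[w1 w2 _].
  split; last by rewrite w1 w2.
  move=> u; rewrite !inE wF2; case: eqP => [->|_]; first by rewrite aF.
  by case: eqP => [->|_]; rewrite ?bF.
have xyF : (x, y) \in F by rewrite Fw !inE eqxx !orbT.
have /and3P[xy xA yB] : [&& adj x y, x \in a :: A & y \in b :: B] by rewrite -inF.
pose c := (a :: A) ++ b :: B.
(* For the length: three edges need three pairs, so the sizes of the two paths have product at least
   three. *)
have cc : is_cycle c.
  rewrite /is_cycle /ucycleb Uc andbT; apply/andP; split.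
    have : size F <= size [seq (x, y) | x <- a :: A, y <- b :: B].
      by rewrite size_filter count_size.
    rewrite sF size_allpairs /c size_cat /=.
    by case: (A) => [|? [|? ?]]; case: (B) => [|? [|? ?]] //=; rewrite addnS.
  by rewrite /= rcons_path cat_path /= last_cat /= ba ab; move: SA SB => /= -> ->.
apply: (hG cc); apply/eqP/cards1P; exists [set x; y].
apply/setP => Z; rewrite inE; apply/imsetP/eqP => [[[u v] /=]|->].
  rewrite inE /= => /and4P[uc vc uv nuv] ->.
  wlog [uA vB] : u v uc vc uv nuv / u \in a :: A /\ v \in b :: B.
    move=> W; move: (uc) (vc); rewrite !mem_cat => /orP[uA|uB] /orP[vA|vB].
    - case/negP: nuv; have := @induced_path_adj (a :: A) u v [::] (b :: B).
      by apply.
    - exact: W.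
    - by rewrite setUC; apply: W; rewrite // 1?adj_sym // cycle_edgeC.
    - case/negP: nuv; have := @induced_path_adj (b :: B) u v (a :: A) [::].
      by rewrite cats0; apply.
  have : (u, v) \in F by rewrite inF uv uA vB.
  rewrite Fw !inE => /or3P[]/eqP[E1 E2].
  - case/negP: nuv; rewrite E1 E2 /c lastI cat_rcons.
    have := @cycle_edge_split (belast a A) (last a A) [::] b B.
    by rewrite -cat_rcons -lastI => ->.
  - case/negP: nuv; rewrite E1 E2 /c [b :: B]lastI -cats1.
    have := @cycle_edge_split [::] a (A ++ belast b B) (last b B) [::].
    by rewrite /= -!catA cats1 -lastI => ->; rewrite // orbT.
  - by rewrite E1 E2.
exists (x, y) => //; rewrite inE /= !mem_cat xA yB xy orbT /=.

(* Vertices of different paths are consecutive on the cycle only at the closing edges, and [(x, y)]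
   is neither of these. *)
have [A1 [A2 EA]] : exists A1 A2, a :: A = A1 ++ x :: A2.
  by case/splitPr: xA => A1 A2; exists A1, A2.
have [B1 [B2 EB]] : exists B1 B2, b :: B = B1 ++ y :: B2.
  by case/splitPr: yB => B1 B2; exists B1, B2.
have Ec : c = A1 ++ x :: (A2 ++ B1) ++ y :: B2 by rewrite /c EA EB -!catA.
rewrite Ec cycle_edge_split -?Ec // cat_nilp.
apply/negP => /orP[/andP[/nilP A20 /nilP B10]|/andP[/nilP B20 /nilP A10]].
  case/eqP: w1; congr pair; last by move: EB; rewrite B10 => -[].
  by rewrite -[last a A]/(last a (a :: A)) EA A20 last_cat.
case/eqP: w2; congr pair; first by move: EA; rewrite A10 => -[].
by rewrite -[last b B]/(last b (b :: B)) EB B20 last_cat.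
Qed.
End Graph.

(** * Shortest paths and holes *)

Section Graph.

Variable G : sgraph.
Implicit Types (x y z s : G) (p q A B C : seq G) (W D S K : {set G}).

Lemma cut_edges_rev A B : cut_edges (rev A) B = cut_edges A B.
Proof. by apply: perm_big; rewrite perm_rev. Qed.

Lemma cut_edges_cons x A B : cut_edges (x :: A) B = count (@adj G x) B + cut_edges A B.
Proof. exact: big_cons. Qed.

Lemma cut_edges_cat A A' B : cut_edges (A ++ A') B = cut_edges A B + cut_edges A' B.
Proof. exact: big_cat. Qed.

Lemma cut_edges0 A B :
  {in A & B, forall x y, ~~ adj x y} -> cut_edges A B = 0.
Proof.
move=> AB; rewrite /cut_edges big_seq big1 // => x xA.
apply/eqP; rewrite -leqn0 leqNgt -has_count; apply/hasPn => y yB; exact: AB.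
Qed.

Lemma cut_edgesC A B : cut_edges A B = cut_edges B A.
Proof.
have E (C C' : seq G) : cut_edges C C' = \sum_(x <- C) \sum_(y <- C') adj x y.
  by apply: eq_bigr => x _; rewrite -sum1_count big_mkcond; apply: eq_bigr => y _; case: adj.
by rewrite !E exchange_big; apply: eq_bigr => x _; apply: eq_bigr => y _; rewrite adj_sym.
Qed.

Lemma count_single (P : pred G) A c : uniq A -> c \in A ->
  {in A, forall z, P z = (z == c)} -> count P A = 1.
Proof. by move=> UA cA /eq_in_count->; rewrite count_uniq_mem // cA. Qed.

Lemma count_pair (P : pred G) A c d : uniq A ->
  {in A, forall z, P z = (z == c) || (z == d)} ->
  count P A = (c \in A) + ((d \in A) && (d != c)).
Proof.
move=> UA /eq_in_count->; case: eqVneq => [->|dc].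
  by rewrite andbF addn0 (@eq_count _ _ (pred1 c)) ?count_uniq_mem // => z /=; rewrite orbb.
have := count_predUI (pred1 c) (pred1 d) A; rewrite !count_uniq_mem // andbT => <-.
rewrite (@eq_count _ (predI _ _) pred0) ?count_pred0 ?addn0 // => z /=.
by apply/andP => -[/eqP-> /eqP E]; rewrite E eqxx in dc.
Qed.

Definition connected W :=
  {in W &, forall x y, connect [rel u v | [&& u \in W, v \in W & adj u v]] x y}.

(** In a shortest walk from [P] to [Q], a chord, a later vertex in [P] or an earlier vertex in [Q]
    would give a shortcut. In the uses, [P] and [Q] express adjacency to vertices outside [W]. *)
Lemma shortest_path W (P Q : pred G) a0 b0 : connected W ->
    a0 \in W -> b0 \in W -> P a0 -> Q b0 ->
  exists a A, [/\ induced_path (a :: A), {subset a :: A <= W},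
    {in a :: A, forall z, P z = (z == a)} &
    {in a :: A, forall z, Q z = (z == last a A)}].
Proof.
move=> cW aW bW Pa Qb.
pose ok p := [&& p != [::], sorted (@adj G) p, all (mem W) p, P (head a0 p) & Q (last a0 p)].
have ex_ok : exists n, [exists t : n.-tuple G, ok t].
  have /connectP[p pp lp] := cW _ _ aW bW.
  exists (size (a0 :: p)); apply/existsP; exists (in_tuple (a0 :: p)).
  rewrite /ok /= Pa -lp Qb aW /= andbT.
  move: pp {lp}; elim: (p) (a0) => //= z s IH x /andP[/and3P[xW zW ->] /IH /andP[-> ->]].
  by rewrite zW.
case: (ex_minnP ex_ok) => n /existsP[t okt] min_n.
have {min_n} min_t p : ok p -> size t <= size p.
  by move=> okp; rewrite size_tuple; apply: min_n; apply/existsP; exists (in_tuple p).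
case: t okt min_t => -[|a A] /= _; rewrite {1}/ok //=.
case/and4P=> pA /andP[aW' sA] Pa' QA min_A.
(* Minimality ranges over walks, so repetitions are removed first; the result is no longer than the
   minimal walk, hence still minimal. *)
have {pA} [A' [pA UA sub lA]] : exists A', [/\ path (@adj G) a A', uniq (a :: A'),
    {subset A' <= A} & last a A' = last a A].
  by case/shortenP: pA => A' *; exists A'.
rewrite -{}lA in QA; have le_A' : size A' <= size A.
  by move: UA => /= /andP[_ U']; apply: uniq_leq_size.
have {sub}sA : {subset a :: A' <= W}.
  by move=> z; rewrite inE => /predU1P[->|/sub/(allP sA)].
have {le_A'} min_ok p : ok p -> (size A').+1 <= size p.
  by move/min_A; apply: leq_trans.
have min_sub p : {subset p <= a :: A'} -> p != [::] -> sorted (@adj G) p ->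
    P (head a0 p) -> Q (last a0 p) -> (size A').+1 <= size p.
  move=> sp p0 srt Pp Qp; apply: min_ok; rewrite /ok p0 srt Pp Qp /= andbT.
  by apply/allP => z /sp /sA.
move=> {ok ex_ok min_A min_ok}; exists a, A'; split=> //.
- split=> // B x C y E def xy.
  have /min_sub : {subset B ++ x :: y :: E <= a :: A'}.
    by move=> z; rewrite def !(mem_cat, inE) => /or4P[] ->; rewrite ?orbT.
  have sort : sorted (@adj G) (a :: A') by [].
  move: sort; rewrite def sorted_cat_cons sorted_cat_cons /= cat_path /= xy => /and4P[-> _ _ ->].
  rewrite -[(size A').+1]/(size (a :: A')) def !size_cat /= size_cat /= !addnS !ltnS.
  have -> : head a0 (B ++ x :: y :: E) = a.
    by have := congr1 (head a0) def; case: (B) => [|? ?] /= ->.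
  have -> : last a0 (B ++ x :: y :: E) = last a A'.
    by have := congr1 (last a0) def; rewrite /= !last_cat /= last_cat => ->.
  have -> : B ++ [:: x, y & E] != [::] by case: (B).
  move=> /(_ isT isT Pa' QA); rewrite addnA leq_add2r -[X in _ <= X]addn0 leq_add2l.
  by rewrite leqn0 => /nilP.
- move=> z zA; apply/idP/eqP => [Pz|-> //].
  have [B [C def]] : exists B C, a :: A' = B ++ z :: C.
    by case/splitPr: zA => B C; exists B, C.
  have /min_sub : {subset z :: C <= a :: A'}.
    by move=> u; rewrite def mem_cat => ->; rewrite orbT.
  have : sorted (@adj G) (a :: A') by [].
  rewrite def => /cat_sorted2[_ -> /(_ isT isT Pz)].
  have -> : last a0 (z :: C) = last a A'.
    by rewrite -[RHS]/(last a0 (a :: A')) def last_cat.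
  move/(_ QA); rewrite -[(size A').+1]/(size (a :: A')) def size_cat.
  rewrite -[X in _ <= X]add0n leq_add2r leqn0 => /nilP B0.
  by move: def; rewrite B0 => -[].
- move=> z zA; apply/idP/eqP => [Qz|-> //].
  have [B [C def]] : exists B C, a :: A' = B ++ z :: C.
    by case/splitPr: zA => B C; exists B, C.
  have /min_sub : {subset rcons B z <= a :: A'}.
    by move=> u; rewrite def -cat_rcons mem_cat => ->.
  have : sorted (@adj G) (a :: A') by [].
  rewrite {1}def sorted_cat_cons => /andP[-> _] /(_ _ isT).
  have -> : head a0 (rcons B z) = a.
    by have := congr1 (head a0) def; case: (B) => [|? ?] /= ->.
  rewrite last_rcons Pa' Qz -[(size A').+1]/(size (a :: A')) def size_cat size_rcons /= addnS.
  move=> /(_ _ isT isT); rewrite ltnS -[X in _ <= X]addn0 leq_add2l leqn0.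
  have -> : rcons B z != [::] by case: (B).
  move=> /(_ isT) /nilP C0; have := congr1 (last a) def; rewrite C0.
  by rewrite last_cat.
Qed.

Definition hole q := is_cycle q /\ {in q &, forall x y, adj x y -> cycle_edge q x y}.

Lemma hole_rot n q : hole q -> hole (rot n q).
Proof.
case=> cq H; have Uq : uniq q by case/and3P: cq.
split; first by rewrite /is_cycle /ucycleb size_rot rot_cycle rot_uniq.
by move=> x y; rewrite !mem_rot cycle_edge_rot //; apply: H.
Qed.

Lemma hole_rot_cat A B : hole (A ++ B) -> hole (B ++ A).
Proof. by move/(hole_rot (size A)); rewrite rot_size_cat. Qed.

Lemma hole_uniq q : hole q -> uniq q.
Proof. by case=> /and3P[]. Qed.

Lemma hole_chordless A x B y C : hole (A ++ x :: B ++ y :: C) -> adj x y ->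
  nilp B || nilp C && nilp A.
Proof.
move=> hq xy; rewrite -(@cycle_edge_split _ A x B y C) ?(hole_uniq hq) //.
by case: hq => _; apply; rewrite // !(mem_cat, inE) eqxx ?orbT.
Qed.

Lemma hole_path A B : hole (A ++ B) -> B != [::] -> induced_path A.
Proof.
move=> hq B0; have := hole_uniq hq; rewrite cat_uniq => /and3P[UA _ _]; split=> //.
  case: hq => /and3P[_ + _] _; case: (A) => //= a A'.
  by rewrite rcons_cat cat_path => /andP[].
move=> A' x B' y C' def xy; move: hq; rewrite def -catA cat_cons -catA cat_cons.
move/hole_chordless/(_ xy)/orP => [/nilP|] //.
by rewrite cat_nilp; case: (B) B0 => //= ? ? _; rewrite andbF.
Qed.

Lemma hole_last x p y : hole (x :: rcons p y) -> adj y x.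
Proof. by case=> /and3P[_ + _]; rewrite /= rcons_path last_rcons => /andP[_ ->]. Qed.

Lemma hole_next A x y B : hole (A ++ x :: y :: B) -> adj x y.
Proof.
by move/hole_rot_cat => [] /and3P[_ + _]; rewrite /= => /andP[->].
Qed.

(** Rotation turns the given edge into the closing edge; the orientation of [q] decides which end
    comes first. *)
Lemma hole_edge q x y : hole q -> x \in q -> y \in q -> adj x y ->
  (exists m, hole (y :: rcons m x) /\ q =i y :: rcons m x) \/
  (exists m, hole (x :: rcons m y) /\ q =i x :: rcons m y).
Proof.
have aux u v : hole q -> u \in q -> next q u = v ->
    exists m, hole (v :: rcons m u) /\ q =i v :: rcons m u.
  move=> hq /rot_to[n p Ep] nu; have := hole_rot 1 (hole_rot n hq).
  rewrite -(next_rot n (hole_uniq hq)) Ep rot1_cons in nu *.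
  have : 2 < size (rot n q) by rewrite size_rot; case: hq => /andP[].
  rewrite Ep; case: p Ep nu => // w p Ep; rewrite next_head => <- _ hw.
  exists p; split=> [//|z]; rewrite -(mem_rot n) Ep !inE mem_rcons inE.
  by rewrite orbCA.
move=> hq xq yq xy; have /and3P[_ _ /orP[]/eqP nx] := hq.2 _ _ xq yq xy.
  by left; apply: aux nx.
by right; apply: aux nx.
Qed.

Hypothesis hG : unique_chord_free G.

(** This is [closed_two_paths] with the first path reversed: the starts are joined, and so are the
    ends. It is the form used below. *)
Lemma no_ladder a A b B :
    induced_path (a :: A) -> induced_path (b :: B) ->
    {in a :: A, forall x, x \notin b :: B} ->
    adj a b -> adj (last a A) (last b B) -> cut_edges (a :: A) (b :: B) = 3 -> False.
Proof.
move=> /induced_path_rev; rewrite -(cut_edges_rev (a :: A)).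
have [R ER] : exists R, rev (a :: A) = last a A :: R.
  by exists (rev (belast a A)); rewrite lastI rev_rcons.
have lR : last (last a A) R = a.
  by rewrite -[LHS]/(last a (last a A :: R)) -ER rev_cons last_rcons.
rewrite ER => IA IB AB ab lab; apply: (closed_two_paths hG) => //.
- by move=> x; rewrite -ER mem_rev; apply: AB.
- by rewrite lR.
- by rewrite adj_sym.
Qed.

(** An edge [s s'] would be the only chord of the cycle formed by a shortest path from [s] to [s']
    through [W] and one through [D]. *)
Lemma connected_attach_stable W D s s' :
    connected W -> connected D -> {in W, forall w, w \notin D} ->
    {in W & D, forall w d, ~~ adj w d} ->
    s \notin W -> s \notin D -> s' \notin W -> s' \notin D ->
    (exists2 w, w \in W & adj s w) -> (exists2 w, w \in W & adj s' w) ->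
    (exists2 d, d \in D & adj s d) -> (exists2 d, d \in D & adj s' d) ->
  ~~ adj s s'.
Proof.
move=> cW cD WD nWD sW sD s'W s'D [w1 w1W sw1] [w2 w2W sw2] [d1 d1D sd1] [d2 d2D sd2].
apply/negP => ss'.
have [a [A [IA AW As As']]] := shortest_path cW w1W w2W sw1 sw2.
have [b [B [IB BD Bs Bs']]] := shortest_path cD d1D d2D sd1 sd2.
have nAB : cut_edges (a :: A) (b :: B) = 0.
  by apply: cut_edges0 => x y /AW xW /BD yD; apply: nWD.
have sA : s \notin a :: A by apply: contra sW => /AW.
have sB : s \notin b :: B by apply: contra sD => /BD.
have s'A : s' \notin a :: A by apply: contra s'W => /AW.
have s'B : s' \notin b :: B by apply: contra s'D => /BD.
(* Cut that cycle so that [s] heads the path in [W] and [s'] ends the one in [D]: the edges across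
   are then [s b], the edge from [last a A] to [s'], and [s s']. *)
apply: (@no_ladder s (a :: A) b (rcons B s')).
- apply: induced_path_cons => //; first by rewrite As ?mem_head.
  move=> z zA; rewrite As ?in_cons ?zA ?orbT //.
  by case: IA => /= /andP[/negP aA _] _ _; apply/eqP => E; case: aA; rewrite -E.
- apply: induced_path_rcons => //; first by rewrite Bs' ?mem_last.
  move=> z zB; rewrite Bs' ?mem_belast //.
  case: IB; rewrite lastI rcons_uniq => /andP[+ _] _ _.
  by apply: contra => /eqP <-.
- move=> z; rewrite inE => /predU1P[->|zA].
    rewrite -rcons_cons mem_rcons inE negb_or sB andbT.
    by apply: contraTneq ss' => ->; rewrite adj_irrefl.
  rewrite -rcons_cons mem_rcons inE negb_or; apply/andP; split.
    by apply: contraNneq s'A => <-.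
  by apply/negP => /BD; apply/negP/WD/AW.
- by rewrite Bs ?mem_head.
- by rewrite last_rcons adj_sym (As' _ (mem_last a A)) /=.
rewrite cut_edges_cons cut_edgesC -rcons_cons -cats1 cut_edges_cat count_cat.
rewrite (count_single _ (mem_head b B)) //; last by case: IB.
rewrite cut_edgesC nAB cut_edges_cons /cut_edges big_nil /= ss'.
rewrite -[_ + count _ _]/(count (@adj G s') (a :: A)).
by rewrite (count_single _ (mem_last a A)) //; case: IA.
Qed.
End Graph.

(** * Neighbours of the separator on a hole *)

Lemma has_first (T : eqType) (P : pred T) (p : seq T) : has P p ->
  exists A a B, [/\ p = A ++ a :: B, P a & {in A, forall z, P z = false}].
Proof.
case/split_find=> a A B Pa /hasPn nA; exists A, a, B; rewrite cat_rcons.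
by split=> // z /nA /negPf.
Qed.

Section Graph.

Variable G : sgraph.
Implicit Types (x y z s : G) (p q A B C : seq G).

Definition triangle_free := forall x y z, @adj G x y -> adj y z -> ~~ adj x z.

Hypotheses (hG : unique_chord_free G) (tfG : triangle_free).
Variables W D S : {set G}.
Hypotheses (cW : connected W) (WD : {in W, forall w, w \notin D})
  (nWD : {in W & D, forall w d, ~~ adj w d}).
Hypotheses (SW : {in S, forall s, s \notin W}) (SD : {in S, forall s, s \notin D})
  (sS : {in S &, forall s s', ~~ adj s s'})
  (aSW : {in S, forall s, exists2 w, w \in W & adj s w}).

(** The interior of the path lies in [W] and sends no edge to [D], so only the ends [s] and [s']
    contribute to the count. *)
Lemma ear s s' : s \in S -> s' \in S -> s != s' ->
  exists a A, [/\ induced_path (s' :: a :: rcons A s), {subset a :: A <= W},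
    {in s' :: a :: rcons A s, forall z, z \notin D} &
    forall Q, {subset Q <= D} ->
      cut_edges (s' :: a :: rcons A s) Q = count (@adj G s) Q + count (@adj G s') Q].
Proof.
move=> sS1 s'S1 ss'.
have [w1 w1W sw1] := aSW s'S1; have [w2 w2W sw2] := aSW sS1.
have [a [A [IA AW As' As]]] := shortest_path cW w1W w2W sw1 sw2.
have sA : s \notin a :: A by apply: contra (SW sS1) => /AW.
have s'A : s' \notin a :: A by apply: contra (SW s'S1) => /AW.
have Ir : induced_path (a :: rcons A s).
  apply: induced_path_rcons => //; first by rewrite (As _ (mem_last a A)) /=.
  move=> z zA; rewrite As ?mem_belast //.
  case: IA; rewrite lastI rcons_uniq => /andP[+ _] _ _.
  by apply: contra => /eqP <-.
exists a, A; split=> //.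
- apply: induced_path_cons => //; last 1 first.
  + move=> z; rewrite mem_rcons inE => /predU1P[->|zA]; first exact: sS.
    rewrite As' ?inE ?zA ?orbT //; case: IA => /= /andP[/negP aA _] _ _.
    by apply/eqP => E; case: aA; rewrite -E.
  + by rewrite -rcons_cons mem_rcons inE eq_sym negb_or ss'.
  + by rewrite (As' _ (mem_head a A)) /=.
- move=> z; rewrite inE -rcons_cons mem_rcons inE => /or3P[/eqP->|/eqP->|/AW zW].
  + exact: SD.
  + exact: SD.
  + exact: WD.
move=> Q QD; rewrite cut_edges_cons -rcons_cons -cats1 cut_edges_cat.
rewrite [cut_edges (a :: A) Q]cut_edges0; last by move=> x y /AW xW /QD; apply: nWD.
by rewrite cut_edges_cons /cut_edges big_nil add0n addn0 addnC.
Qed.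

(** The ear from [s'] to [s] and the path in [D] form a ladder, and the sum counts the edges between
    them. *)
Lemma ear_count s s' y m : s \in S -> s' \in S -> s != s' ->
    induced_path (y :: m) -> {subset y :: m <= D} -> adj s' y -> adj s (last y m) ->
  count (@adj G s) (y :: m) + count (@adj G s') (y :: m) <> 3.
Proof.
move=> sS1 s'S1 ss' IQ QD s'y sl E.
have [a [A [IE _ ED cE]]] := ear sS1 s'S1 ss'.
apply: (no_ladder hG IE IQ) => //; last by rewrite cE.
  by move=> z /ED; apply: contra; apply: QD.
by rewrite /= last_rcons.
Qed.

Section Hole.

Variable q : seq G.
Hypotheses (hq : hole q) (qD : {subset q <= D}).

(** With a third neighbour of [s], the arc from [x] to the third one closes with [s] into a cycle
    whose only chord joins [s] to the second. The value [x' = x] stands for a single neighbour. *)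
Lemma hole_nbrs s x : s \notin q -> x \in q -> adj s x -> exists x',
  [/\ x' \in q, adj s x' & {in q, forall z, adj s z = (z == x) || (z == x')}].
Proof.
move=> sq xq sx; case/rot_to: (xq) => n p Ep.
have hp := hole_rot n hq; rewrite Ep in hp.
have qp : q =i x :: p by move=> z; rewrite -(mem_rot n) Ep.
have [/has_first[A [a [B [Eq_p sa nA]]]]|/hasPn np] := boolP (has (adj s) p); last first.
  exists x; split=> // z; rewrite qp orbb inE => /predU1P[->|zp].
    by rewrite sx eqxx.
  by rewrite (negPf (np _ zp)); apply/esym/eqP => E; case/negP: (np _ zp); rewrite E.
have aq : a \in q by rewrite qp Eq_p !(inE, mem_cat) eqxx !orbT.
have [/has_first[B' [b [C [EB sb nB]]]]|/hasPn nB] := boolP (has (adj s) B); last first.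
  exists a; split=> // z; rewrite qp Eq_p inE mem_cat inE.
  case: eqVneq => [->|zx] //=; case: eqVneq => [->|za] /=; first by rewrite sa orbT.
  by case/orP => [/nA|/nB /negPf].
exfalso; move: hp; rewrite Eq_p EB => hp.
(* If [C] were empty, [b] and [x] would be consecutive on the hole and form a triangle with [s]. *)
have C0 : C != [::].
  apply/eqP => E; move: hp; rewrite E cats1 -rcons_cons -rcons_cat => /hole_last bx.
  by have := tfG sb bx; rewrite sx.
have Qe : x :: A ++ a :: B' ++ b :: C = (x :: rcons (A ++ a :: B') b) ++ C.
  by rewrite -cats1 /= -!catA.
rewrite Qe in hp; have Qq : {subset x :: rcons (A ++ a :: B') b <= q}.
  by move=> z zQ; rewrite qp Eq_p EB Qe mem_cat zQ.
apply: (no_ladder hG (induced_path1 s) (hole_path hp C0)) => //.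
- by move=> z; rewrite inE => /eqP->; apply: contra sq => /Qq.
- by rewrite last_rcons.
rewrite cut_edges_cons /cut_edges big_nil addn0 /= sx -cats1 !count_cat /= sa sb.
have c0 E : {in E, forall z, adj s z = false} -> count (adj s) E = 0.
  by move=> nE; rewrite (eq_in_count nE) count_pred0.
by rewrite !c0.
Qed.

Lemma count_nbrs s x x' Q : uniq Q -> {subset Q <= q} ->
    {in q, forall z, adj s z = (z == x) || (z == x')} ->
  count (adj s) Q = (x \in Q) + ((x' \in Q) && (x' != x)).
Proof. by move=> UQ Qq H; apply: count_pair => // z /Qq /H. Qed.

(* If [x0 <> x1], then [s], [s0], a path between them through [W] and the arc of [q] between
   [x] and [x0] that avoids [x1] form a cycle whose only chord is [s0 x] or [s0 x0]. *)
Lemma nbrs_block s s0 x x1 x0 : s \in S -> s0 \in S -> x \in q -> x1 \in q -> x0 \in q ->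
    {in q, forall z, adj s z = (z == x) || (z == x1)} ->
    {in q, forall z, adj s0 z = (z == x) || (z == x0)} -> x0 != x -> x0 = x1.
Proof.
move=> sS1 s0S xq x1q x0q Ns Ns0 nx; apply/eqP/negPn/negP => n01.
have ss0 : s != s0.
  by apply/eqP => E; have := Ns _ x0q; rewrite E Ns0 // (negPf nx) (negPf n01) eqxx.
have [sx s0x s0x0] : [/\ adj s x, adj s0 x & adj s0 x0].
  by rewrite Ns // !Ns0 // !eqxx orbT.
case/rot_to: (xq) => n p Ep.
have hp := hole_rot n hq; rewrite Ep in hp.
have qp : q =i x :: p by move=> z; rewrite -(mem_rot n) Ep.
have x0p : x0 \in p by move: x0q; rewrite qp inE (negPf nx).
have [A [B EAB]] : exists A B, p = A ++ x0 :: B by case/splitPr: x0p => A B; exists A, B.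
have Uq := hole_uniq hp.
have x0x : ~~ adj x0 x by apply: (tfG _ s0x); rewrite adj_sym.
have qA z : z \in x :: p -> z \in q by rewrite qp.
have x1p := x1q; rewrite qp EAB in x1p.
rewrite EAB in Uq hp qA.
(* Of the two arcs between [x] and [x0], take one without [x1] in its interior: on it [s] sees only
   [x], while [s0] sees both ends. *)
have [x1A|x1A] := boolP (x1 \in A).
  have hr : hole ((x0 :: rcons B x) ++ A).
    by rewrite cat_cons cat_rcons; apply: (@hole_rot_cat _ (x :: A) (x0 :: B)).
  have sub : {subset x0 :: rcons B x <= q}.
    move=> z zQ; apply: qA; rewrite -cat_cons mem_cat orbC.
    by move: zQ; rewrite !inE mem_rcons inE; case/or3P => ->; rewrite ?orbT.
  have A0 : A != [::] by case: (A) x1A.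
  have IQ := hole_path hr A0; have [UQ _ _] := IQ.
  have := @ear_count s s0 x0 (rcons B x) sS1 s0S ss0 IQ.
  move=> H; apply: H => //; first by move=> z /sub /qD.
    by rewrite last_rcons.
  rewrite (count_nbrs UQ sub Ns) (count_nbrs UQ sub Ns0).
  have x1B : x1 \notin x0 :: rcons B x.
    by move: (hole_uniq hr); rewrite cat_uniq => /and3P[_ /hasPn/(_ _ x1A) + _].
  by rewrite (negPf x1B) mem_head nx -rcons_cons mem_rcons mem_head.
have B0 : B != [::].
  apply/eqP => E; case/negP: x0x; move: hp; rewrite E cats1; exact: hole_last.
have hr : hole ((x :: rcons A x0) ++ B) by rewrite cat_cons cat_rcons.
have IQ := hole_path hr B0; have [UQ _ _] := IQ.
have sub : {subset x :: rcons A x0 <= q}.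
  by move=> z zQ; apply: qA; rewrite -cat_rcons -cat_cons mem_cat zQ.
have s0s : s0 != s by rewrite eq_sym.
apply: (@ear_count s0 s x (rcons A x0) s0S sS1 s0s IQ) => //; first by move=> z /sub /qD.
  by rewrite last_rcons.
rewrite (count_nbrs UQ sub Ns) (count_nbrs UQ sub Ns0).
rewrite mem_head -rcons_cons mem_rcons mem_head nx.
rewrite mem_rcons !inE eq_sym (negPf n01) (negPf x1A) orbF /=.
by case: (x1 == x).
Qed.

End Hole.

(* Both [x' = x] and [y' = y] may not hold, but one of them may: then the other
   block consists of the two neighbours on [q] of the first vertex. *)
Lemma nbrs_edge_aux s s' x x' y y' m (q := y :: rcons m x) :
    hole q -> {subset q <= D} -> s \in S -> s' \in S -> x' \in q -> y' \in q ->
    {in q, forall z, adj s z = (z == x) || (z == x')} ->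
    {in q, forall z, adj s' z = (z == y) || (z == y')} ->
  adj x' y' /\ ~ (x' = x /\ y' = y).
Proof.
move=> hq qD sS1 s'S xq yq Ns Ns'.
have Uq := hole_uniq hq.
have xy : adj x y by apply: (@hole_last _ y m x).
have inx : x \in q by rewrite /q -rcons_cons mem_rcons mem_head.
have iny : y \in q by rewrite mem_head.
have nxy : (x == y) = false by apply: contraTF xy => /eqP->; rewrite adj_irrefl.
have [sx sx'] : adj s x /\ adj s x' by rewrite !Ns // !eqxx orbT.
have [s'y s'y'] : adj s' y /\ adj s' y' by rewrite !Ns' // !eqxx orbT.
have sy : adj s y = false by apply/negP => sy; have := tfG sx xy; rewrite sy.
have s'x : adj s' x = false by apply/negP => s'x; have := tfG s'x xy; rewrite s'y.
have ss' : s != s' by apply: contraFneq sy => ->.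
have x'y : x' != y by apply: contraFneq sy => <-.
have y'x : y' != x by apply: contraFneq s'x => <-.
have x'm : x' = x \/ x' \in m.
  by move: xq; rewrite inE (negPf x'y) mem_rcons inE => /predU1P.
have y'm : y' = y \/ y' \in m.
  by move: yq; rewrite inE mem_rcons inE (negPf y'x) => /predU1P.
have cnt Q : uniq Q -> {subset Q <= q} ->
    count (adj s) Q = (x \in Q) + ((x' \in Q) && (x' != x)) /\
    count (adj s') Q = (y \in Q) + ((y' \in Q) && (y' != y)).
  by move=> UQ Qq; split; apply: count_pair => // z /Qq; [apply: Ns | apply: Ns'].
(* [ear_count] for a proper arc of [q] with one end adjacent to [s] and the other to [s']; the
   summands record which vertices of the two blocks lie on the arc. *)
have segment u Q v B : hole ((u :: rcons Q v) ++ B) -> B != [::] ->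
    {subset u :: rcons Q v <= q} ->
    adj s' u && adj s v || adj s u && adj s' v ->
    (x \in u :: rcons Q v) + ((x' \in u :: rcons Q v) && (x' != x)) +
    ((y \in u :: rcons Q v) + ((y' \in u :: rcons Q v) && (y' != y))) <> 3.
  move=> hB B0 sub ends; have IQ := hole_path hB B0; have [UQ _ _] := IQ.
  have [<- <-] := cnt _ UQ sub.
  have subD : {subset u :: rcons Q v <= D} by move=> z /sub; apply: qD.
  case/orP: ends => /andP[su sv]; first by apply: ear_count; rewrite ?last_rcons.
  by rewrite addnC; apply: ear_count; rewrite ?last_rcons // eq_sym.
have {x'm} [x'x|x'm] := x'm; have {y'm} [y'y|y'm] := y'm.
(* Both blocks are single vertices: the ear from [s'] to [s], extended by [x] and closed by
   [y :: m], is a cycle whose only chord is [x y]. *)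
- exfalso; rewrite x'x y'y in cnt.
  have [a [A [IE AW ED cE]]] := ear sS1 s'S ss'.
  have hQ : hole ((y :: m) ++ [:: x]) by rewrite cats1.
  have IQ := hole_path hQ isT; have [UQ _ _] := IQ.
  have sub : {subset y :: m <= q}.
    by move=> z zQ; rewrite /q -cats1 -cat_cons mem_cat zQ.
  have xE : x \notin s' :: a :: rcons A s by apply/negP => /ED; rewrite qD.
  have IP : induced_path (s' :: rcons (a :: rcons A s) x).
    apply: induced_path_rcons => //; first by rewrite /= last_rcons adj_sym.
    rewrite -rcons_cons belast_rcons => z; rewrite inE => /predU1P[->|/AW zW].
      by rewrite adj_sym s'x.
    by rewrite adj_sym; apply: nWD => //; apply: qD.
  apply: (no_ladder hG IP IQ) => //.
  + move=> z; rewrite -rcons_cons mem_rcons inE => /predU1P[->|zE].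
      by move: Uq; rewrite /q -rcons_cons rcons_uniq => /andP[].
    by apply/negP => /sub /qD; apply/negP; apply: ED.
  + rewrite last_rcons; move: hq; rewrite /q -cats1.
    case/lastP: (m) => //= m' w; rewrite last_rcons cat_rcons adj_sym.
    exact: (@hole_next _ (y :: m')).
  rewrite -rcons_cons -cats1 cut_edges_cat cE; last by move=> z /sub /qD.
  have [-> ->] := cnt _ UQ sub; rewrite !eqxx !andbF.
  have xm : x \notin y :: m by move: Uq; rewrite /q -rcons_cons rcons_uniq => /andP[].
  rewrite (negPf xm) mem_head cut_edges_cons /cut_edges big_nil /= xy.
  have : 2 < size q by case: (hq) => /andP[].
  rewrite /q /= size_rcons; move: hq; rewrite /q; case/lastP: (m) => // m' w hq'' _.
  rewrite -cats1 count_cat /= adj_sym (@hole_next _ (y :: m') w x [::]); last first.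
    by rewrite cat_cons -cat_rcons cats1.
  rewrite (@eq_in_count _ _ pred0) ?count_pred0 // => z zm.
  have [A1 [A2 Em]] : exists A1 A2, m' = A1 ++ z :: A2.
    by case/splitPr: zm => A1 A2; exists A1, A2.
  have hz : hole ((y :: A1) ++ z :: rcons A2 w ++ x :: [::]).
    by rewrite cats1 cat_cons -!rcons_cons -rcons_cat -rcons_cons -rcons_cat -Em.
  rewrite adj_sym; apply/negbTE/negP => /(hole_chordless hz).
  by rewrite andbF orbF; case: (A2).
(* If [y'] is not the vertex just before [x], the arc from [x] through [y] to [y'] is proper and
   carries three edges: [s x], [s' y], [s' y']. *)
- have [m1 [m2 Em]] : exists m1 m2, m = m1 ++ y' :: m2.
    by case/splitPr: y'm => m1 m2; exists m1, m2.
  split; last by case=> _ E; move: Uq; rewrite /q Em E /= mem_rcons !(inE, mem_cat) eqxx !orbT.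
  have hq1 : hole ((x :: rcons (y :: m1) y') ++ m2).
    have -> : (x :: rcons (y :: m1) y') ++ m2 = [:: x] ++ y :: m by rewrite Em /= cat_rcons.
    by apply: hole_rot_cat; rewrite cats1.
  case: (eqVneq m2 [::]) hq1 => [->|m20 hq1].
    by rewrite cats0 x'x => /hole_last; rewrite adj_sym.
  exfalso; apply: (segment _ _ _ _ hq1 m20).
  + move=> z zQ; have : z \in (x :: rcons (y :: m1) y') ++ m2 by rewrite mem_cat zQ.
    by rewrite /q Em /= cat_rcons !inE mem_rcons inE !mem_cat !inE orbCA.
  + by rewrite sx s'y' /= orbT.
  have y'y : y' != y.
    by apply: contraTneq Uq => E; rewrite /q Em E /= mem_rcons !(inE, mem_cat) eqxx !orbT.
  by rewrite x'x eqxx andbF !(inE, mem_rcons) !eqxx !orbT /= y'y.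
- have [m1 [m2 Em]] : exists m1 m2, m = m1 ++ x' :: m2.
    by case/splitPr: x'm => m1 m2; exists m1, m2.
  have x'x : x' != x.
    apply: contraTneq Uq => E; rewrite /q Em E -rcons_cons rcons_uniq negb_and.
    by rewrite !(inE, mem_cat) eqxx !orbT.
  split; last by case=> E; rewrite E eqxx in x'x.
  have hq1 : hole ((x' :: rcons (rcons m2 x) y) ++ m1).
    rewrite cat_cons cat_rcons; apply: (@hole_rot_cat _ (y :: m1) (x' :: rcons m2 x)).
    by move: hq; rewrite /q Em rcons_cat.
  case: (eqVneq m1 [::]) hq1 => [->|m10 hq1].
    by rewrite cats0 y'y => /hole_last; rewrite adj_sym.
  exfalso; apply: (segment _ _ _ _ hq1 m10).
  + move=> z; rewrite /q Em rcons_cat rcons_cons !(inE, mem_rcons, mem_cat).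
    by case/or4P => ->; rewrite ?orbT.
  + by rewrite sx' s'y orbT.
  by rewrite y'y eqxx andbF !(inE, mem_rcons) !eqxx !orbT /= x'x.
have [m1 [m2 Em]] : exists m1 m2, m = m1 ++ x' :: m2.
  by case/splitPr: x'm => m1 m2; exists m1, m2.
have Eq : q = (y :: rcons m1 x') ++ rcons m2 x by rewrite /q Em /= cat_rcons rcons_cat.
have sub1 : {subset y :: rcons m1 x' <= q} by move=> z zQ; rewrite Eq mem_cat zQ.
have hq1 := hq; rewrite Eq in hq1.
have m2x0 : rcons m2 x != [::] by case: (m2).
have x1 : x \notin y :: rcons m1 x'.
  move: (hole_uniq hq1); rewrite cat_uniq => /and3P[_ /hasPn + _]; apply.
  by rewrite mem_rcons mem_head.
have x'x : x' != x by apply: contraNneq x1 => <-; rewrite -rcons_cons mem_rcons mem_head.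
have y'y : y' != y.
  by apply: contraTneq Uq => E; rewrite /q /= mem_rcons inE -E y'm orbT.
split; last by case=> E; rewrite E eqxx in x'x.
(* If [y'] lies on the arc from [y] to [x'], this arc carries the three edges [s' y], [s' y'],
   [s x']. *)
have [y'1|y'1] := boolP (y' \in y :: rcons m1 x').
  exfalso; apply: (segment _ _ _ _ hq1) => //; first by rewrite s'y sx'.
  by rewrite (negPf x1) y'1 mem_head -rcons_cons mem_rcons mem_head x'x y'y.
have y'2 : y' \in m2.
  have := yq; rewrite Eq mem_cat (negPf y'1) mem_rcons inE.
  by rewrite (negPf y'x).
have [p2 [p3 Em2]] : exists p2 p3, m2 = p2 ++ y' :: p3.
  by case/splitPr: y'2 => p2 p3; exists p2, p3.
have hq2 : hole ((y :: rcons m1 x') ++ p2 ++ y' :: rcons p3 x).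
  by move: hq1; rewrite Em2 rcons_cat rcons_cons.
have [p20|p20] := eqVneq p2 [::].
  move: hq2; rewrite p20 -rcons_cons cat_rcons; exact: hole_next.
(* The arcs from [y] to [x'] and from [y'] to [x] are separated by the nonempty [p2], so [x y] is
   the only edge between them. Appending [s] to the first and putting [s'] before the second gives a
   cycle whose only chord is [x y]. *)
exfalso.
have hq3 := hole_rot_cat hq2; rewrite -catA in hq3; have hq3' := hole_rot_cat hq3.
rewrite -catA in hq3'.
have IP0 := hole_path hq1 m2x0; have [UP0 _ _] := IP0.
have IQ0 : induced_path (y' :: rcons p3 x) by apply: hole_path hq3' _.
have [UQ0 _ _] := IQ0.
have sub2 : {subset y' :: rcons p3 x <= q}.
  by move=> z zQ; rewrite Eq Em2 rcons_cat !mem_cat rcons_cons zQ !orbT.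
have x2 : x \in y' :: rcons p3 x by rewrite -rcons_cons mem_rcons mem_head.
have dis : {in y :: rcons m1 x', forall z, z \notin y' :: rcons p3 x}.
  move=> z zP; apply/negP => zQ; move: (hole_uniq hq2); rewrite cat_uniq.
  by case/and3P => _ /hasPn/(_ z) + _; rewrite mem_cat zQ orbT zP => /(_ isT).
have adjPQ u v : u \in y :: rcons m1 x' -> v \in y' :: rcons p3 x ->
    adj u v = (u == y) && (v == x).
  move=> uP vQ; apply/idP/andP => [uv|[/eqP-> /eqP->]]; last by rewrite adj_sym.
  have [A1 [A2 EP]] : exists A1 A2, y :: rcons m1 x' = A1 ++ u :: A2.
    by case/splitPr: uP => A1 A2; exists A1, A2.
  have [B1 [B2 EQ]] : exists B1 B2, y' :: rcons p3 x = B1 ++ v :: B2.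
    by case/splitPr: vQ => B1 B2; exists B1, B2.
  have := hole_chordless (_ : hole (A1 ++ u :: (A2 ++ p2 ++ B1) ++ v :: B2)) uv.
  have -> : A1 ++ u :: (A2 ++ p2 ++ B1) ++ v :: B2 = (y :: rcons m1 x') ++ p2 ++ y' :: rcons p3 x.
    by rewrite EP EQ -!catA.
  move=> /(_ hq2); rewrite !cat_nilp; case: (p2) p20 => //= ? ? _; rewrite andbF /=.
  case/andP=> /nilP B20 /nilP A10; move: EP EQ; rewrite B20 A10 => -[-> _].
  by rewrite cats1 -rcons_cons => /rcons_inj[_ ->]; rewrite !eqxx.
have sN z : z \in q -> z != s by move=> /qD; apply: contraTneq => ->; apply: SD.
have s'N z : z \in q -> z != s' by move=> /qD; apply: contraTneq => ->; apply: SD.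
apply: (@no_ladder _ hG y (rcons (rcons m1 x') s) s' (y' :: rcons p3 x)).
- apply: induced_path_rcons => //; first by apply/negP => /sub1/sN; rewrite eqxx.
    by rewrite last_rcons.
  rewrite belast_rcons => z zm.
  have zP : z \in y :: rcons m1 x' by rewrite -rcons_cons mem_rcons inE zm orbT.
  rewrite Ns; last exact: sub1.
  rewrite negb_or; apply/andP; split; first by apply: contraNneq x1 => <-.
  by apply: contraTneq UP0 => E; rewrite -rcons_cons rcons_uniq -E zm.
- apply: induced_path_cons => //; first by apply/negP => /sub2/s'N; rewrite eqxx.
  move=> z zp; rewrite Ns'; last by apply: sub2; rewrite inE zp orbT.
  rewrite negb_or; apply/andP; split; last first.
    by apply: contraTneq UQ0 => <-; rewrite /= zp.
  by apply: contraTneq zp => ->; have := dis y (mem_head _ _); rewrite inE negb_or => /andP[].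
- move=> z; rewrite -rcons_cons mem_rcons inE => /predU1P[->|zP].
    by rewrite inE negb_or ss'; apply/negP => /sub2/sN; rewrite eqxx.
  by rewrite inE negb_or s'N ?dis //; apply: sub1.
- by rewrite adj_sym.
- by rewrite last_rcons /= last_rcons.
rewrite -rcons_cons -cats1 cut_edges_cat [cut_edges [:: s] _]cut_edges_cons.
rewrite {2}/cut_edges big_nil addn0.
rewrite -[count _ (s' :: _)]/(adj s s' + count (adj s) (y' :: rcons p3 x)).
rewrite (negPf (sS sS1 s'S)) add0n.
have [-> _] := cnt _ UQ0 sub2; rewrite x2.
have -> : x' \in y' :: rcons p3 x = false.
  by apply/negbTE/dis; rewrite -rcons_cons mem_rcons mem_head.
rewrite cut_edgesC cut_edges_cons; have [_ ->] := cnt _ UP0 sub1.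
rewrite mem_head (negPf y'1) cut_edgesC cut_edges_cons.
rewrite (@count_single _ _ _ x) // => [|z zQ]; last by rewrite adjPQ ?mem_head ?eqxx.
rewrite cut_edges0 // => u v uP vQ; rewrite adjPQ ?inE ?uP ?orbT //.
by apply: contraTN uP => /andP[/eqP-> _]; case/andP: UP0.
Qed.

End Graph.

(** * Parity *)

Lemma even_involution (T : finType) (A : {set T}) (f : T -> T) :
  {in A, forall x, [/\ f x \in A, f (f x) = x & f x != x]} -> ~~ odd #|A|.
Proof.
have [n] := ubnP #|A|; elim: n A => // n IH A lt_An fA.
have [->|[x xA]] := set_0Vmem A; first by rewrite cards0.
have [fxA ffx nfx] := fA x xA.
have fxA' : f x \in A :\ x by rewrite !inE nfx.
rewrite (cardsD1 x A) xA (cardsD1 (f x)) fxA' /= negbK.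
apply: IH => [|y].
  by move: lt_An; rewrite (cardsD1 x A) xA (cardsD1 (f x)) fxA' /= => /ltnW; rewrite !add1n ltnS.
rewrite !inE => /and3P[yfx yx yA]; have [fyA ffy nfy] := fA y yA.
split=> //; rewrite fyA andbT; apply/andP; split.
  by apply: contraNneq yx => E; rewrite -ffy E ffx.
by apply: contraNneq yfx => <-; rewrite ffy.
Qed.

Section Graph.

Variable G : sgraph.
Implicit Types (x y z s : G) (p q A B C : seq G).

Hypotheses (hG : unique_chord_free G) (tfG : triangle_free G).
Variables W D S : {set G}.
Hypotheses (cW : connected W) (WD : {in W, forall w, w \notin D})
  (nWD : {in W & D, forall w d, ~~ adj w d}).
Hypotheses (SW : {in S, forall s, s \notin W}) (SD : {in S, forall s, s \notin D})
  (sS : {in S &, forall s s', ~~ adj s s'})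
  (aSW : {in S, forall s, exists2 w, w \in W & adj s w}).
Variable q : seq G.
Hypotheses (hq : hole q) (qD : {subset q <= D}).

Definition attached x := [exists s in S, adj s x].

(** By [nbrs_block] the block of [x] does not depend on the choice of [s]. The conditions on [x]
    stand under the existential so that a partner function can be chosen on all vertices. *)
Lemma ex_partner x : exists x', x \in q -> attached x ->
  [/\ x' \in q, attached x' &
      {in S, forall s, adj s x -> {in q, forall z, adj s z = (z == x) || (z == x')}}].
Proof.
have [xq|] := boolP (x \in q); last by exists x.
have [/exists_inP[s0 s0S s0x]|] := boolP (attached x); last by exists x.
have qN s : s \in S -> s \notin q by move=> /SD; apply: contra => /qD.
have [x0 [x0q s0x0 N0]] := hole_nbrs hG tfG hq (qN _ s0S) xq s0x.
exists x0 => _ _; split=> //; first by apply/exists_inP; exists s0.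
move=> s sS1 sx; have [x1 [x1q sx1 N1]] := hole_nbrs hG tfG hq (qN _ sS1) xq sx.
have block := nbrs_block hG tfG cW WD nWD SW SD sS aSW hq qD.
move=> z zq; rewrite N1 //.
have [x0x|x0x] := eqVneq x0 x; last by rewrite (block _ _ _ _ _ sS1 s0S xq x1q x0q N1 N0 x0x).
have [x1x|x1x] := eqVneq x1 x; first by rewrite x0x x1x.
by rewrite (block _ _ _ _ _ s0S sS1 xq x0q x1q N0 N1 x1x).
Qed.

(** Each edge of [q] is represented by its tail [x]. By [nbrs_edge_aux], taking partners of both
    ends maps edges with attached ends to such edges and fixes none. *)
Lemma hole_even_attached :
  ~~ odd #|[set x in q | attached x && attached (next q x)]|.
Proof.
have [pt ptP] := fin_all_exists ex_partner.
have ptK x : x \in q -> attached x -> pt (pt x) = x.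
  move=> xq ax; have [pq ap Np] := ptP x xq ax.
  have [ppq app Npp] := ptP _ pq ap.
  have [s sS1 sx] := exists_inP ax.
  have spx : adj s (pt x) by rewrite (Np s) // eqxx orbT.
  have := Npp s sS1 spx x xq; rewrite sx => /esym/orP[/eqP E|/eqP//].
  by rewrite -!E.
have ptN x y : x \in q -> attached x -> adj x y -> pt x <> y.
  move=> xq ax xy E; have [pq ap Np] := ptP x xq ax.
  have [s sS1 sx] := exists_inP ax.
  have := Np s sS1 sx _ pq; rewrite eqxx orbT E => sy.
  by have := tfG sx xy; rewrite sy.
have pt_edge x y : x \in q -> y \in q -> attached x -> attached y -> adj x y ->
    adj (pt x) (pt y) /\ ~ (pt x = x /\ pt y = y).
  have aux u v m : hole (v :: rcons m u) -> q =i v :: rcons m u -> attached u -> attached v ->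
      adj (pt u) (pt v) /\ ~ (pt u = u /\ pt v = v).
    move=> hm qm au av; have [s sS1 su] := exists_inP au; have [s' s'S s'v] := exists_inP av.
    have uq : u \in q by rewrite qm -rcons_cons mem_rcons mem_head.
    have vq : v \in q by rewrite qm mem_head.
    have [puq _ /(_ s sS1 su) Nu] := ptP u uq au.
    have [pvq _ /(_ s' s'S s'v) Nv] := ptP v vq av.
    have mq : {subset v :: rcons m u <= D} by move=> z; rewrite -qm; apply: qD.
    by apply: (nbrs_edge_aux hG tfG cW WD nWD SW SD sS aSW hm mq sS1 s'S);
      rewrite -?qm // => z; rewrite -qm; [apply: Nu | apply: Nv].
  move=> xq yq ax ay xy; have [[m [hm qm]]|[m [hm qm]]] := hole_edge hq xq yq xy.
    exact: aux hm qm ax ay.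
  have [pxy npxy] := aux _ _ _ hm qm ay ax; rewrite adj_sym; split=> [//|[? ?]]; exact: npxy.
(* [f x] is the tail of the image edge, which may be traversed in either direction. *)
pose f x := if next q (pt x) == pt (next q x) then pt x else pt (next q x).
have cq : cycle (@adj G) q by case: hq => /and3P[].
apply: (@even_involution _ _ f) => x; rewrite inE => /and3P[xq ax ay].
have yq : next q x \in q by rewrite mem_next.
have xy : adj x (next q x) := next_cycle cq xq.
have [pxq apx _] := ptP x xq ax; have [pyq apy _] := ptP _ yq ay.
have [pxy npxy] := pt_edge x _ xq yq ax ay xy.
rewrite /f; case: eqP => [E|nE].
  rewrite E !ptK // eqxx; split=> //; first by rewrite inE E pxq apx apy.
  by apply/eqP => px; apply: npxy; rewrite -E px.
have /and3P[_ _ /orP[/eqP//|/eqP E]] := hq.2 _ _ pxq pyq pxy.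
(* As [q] has more than two vertices, an edge has only one tail, so a second application of [f]
   takes the reversing branch again. *)
have nyx : next q (next q x) == x = false.
  have Uq := hole_uniq hq; have : 2 < size q by case: hq => /andP[].
  case/rot_to: (xq) => n p Ep; rewrite -(size_rot n) -!(next_rot n Uq) Ep.
  case: p Ep => [|y [|z p]] // Ep _; rewrite next_head.
  have U1 : uniq [:: x, y, z & p] by rewrite -Ep rot_uniq.
  rewrite -(next_rot 1 U1) rot1_cons /= eqxx.
  by apply: contraTF U1 => /eqP->; rewrite /= !inE eqxx !orbT.
rewrite E !ptK // nyx; split=> //; first by rewrite inE E pyq apx apy.
by apply/eqP; apply: ptN; rewrite // adj_sym.
Qed.
End Graph.

(** * Balanced signed graphs *)

Section Balance.

Variables (G : sgraph) (D : {set G}) (w : rel G).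
Hypothesis (wC : symmetric w).
Implicit Types (x y z : G) (p q A B C : seq G).

(** Signs are booleans, with [true] for negative, so that products of signs become [(+)]. *)
Fixpoint walk_sign x p := if p is y :: p' then w x y (+) walk_sign y p' else false.

Lemma walk_sign_cat x p p' :
  walk_sign x (p ++ p') = walk_sign x p (+) walk_sign (last x p) p'.
Proof. by elim: p x => //= y p IH x; rewrite IH addbA. Qed.

Definition odd_closed q :=
  if q is x :: p then
    [&& path (@adj G) x (rcons p x), all (mem D) q & walk_sign x (rcons p x)]
  else false.

Lemma odd_closed_cat A B : odd_closed (A ++ B) = odd_closed (B ++ A).
Proof.
case: A B => [|x A] [|y B]; rewrite ?cats0 //.
rewrite /odd_closed !cat_cons !rcons_cat !rcons_cons !walk_sign_cat !cat_path.
rewrite -!cat_cons !all_cat -!cats1 /= !walk_sign_cat !cat_path /= !addbF !andbT.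
do 2![case: path => /=]; rewrite ?andbF //.
congr [&& _, _ & _]; first by rewrite andbC.
  exact: andbC.
by rewrite addbA addbC -addbA.
Qed.

Lemma odd_closed_rot n q : odd_closed (rot n q) = odd_closed q.
Proof. by rewrite /rot odd_closed_cat cat_take_drop. Qed.

(** A repeated vertex or a chord splits a closed walk into two shorter ones, and one of these is odd
    if the whole is. *)
Lemma odd_closed_hole q : odd_closed q ->
    (forall p, odd_closed p -> size q <= size p) ->
  [/\ hole q, {subset q <= D} & odd #|[set x in q | w x (next q x)]|].
Proof.
move=> oq min_q.
have qD : {subset q <= D} by case: (q) oq => // x p /and3P[_ /allP].
have cq : cycle (@adj G) q by case: (q) oq => // x p /and3P[].
have split x A y B n : rot n q = x :: A ++ y :: B ->
  [/\ path (@adj G) x (rcons A y), path (@adj G) y (rcons B x),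
      {subset x :: rcons A y <= D}, {subset y :: rcons B x <= D} &
      walk_sign x (rcons A y) (+) walk_sign y (rcons B x)].
  move=> Eq; move: oq; rewrite -(odd_closed_rot n) Eq /odd_closed.
  have -> : rcons (A ++ y :: B) x = rcons A y ++ rcons B x by rewrite rcons_cat cat_rcons.
  rewrite cat_path walk_sign_cat last_rcons => /and3P[/andP[pA pB] _ sg].
  have sub : {subset x :: A ++ y :: B <= D} by move=> z; rewrite -Eq mem_rot; apply: qD.
  split=> // z zp; apply: sub; move: zp; rewrite !(inE, mem_rcons, mem_cat).
    by case/or3P => ->; rewrite ?orbT.
  by case/or3P => ->; rewrite ?orbT.
have odd_size p : odd_closed p -> size p < size q -> False.
  by move/min_q; rewrite leqNgt => /negP.
have Uq : uniq q.
  apply: count_mem_uniq => x; have [xq|/count_memPn//] := boolP (x \in q).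
  case/rot_to: (xq) => n p Ep; have /seq.permP<- : perm_eq (rot n q) q by rewrite perm_rot.
  rewrite Ep /= eqxx.
  apply/eqP; rewrite eqSS -[_ == 0]negbK -lt0n -has_count has_pred1.
  apply/negP => xp; have [A [B EAB]] : exists A B, p = A ++ x :: B.
    by case/splitPr: xp => A B; exists A, B.
  have sz : size q = (size A + size B).+2.
    by rewrite -(size_rot n) Ep EAB /= size_cat /= addnS.
  rewrite EAB in Ep; have [pA pB sA sB sg] := split _ _ _ _ _ Ep.
  have allx C : {subset x :: rcons C x <= D} -> all (mem D) (x :: C).
    move=> sC; apply/allP => z zC; apply: sC.
    by rewrite -rcons_cons mem_rcons inE zC orbT.
  move: sg; case sgA: (walk_sign x (rcons A x)) => /= sgB.
    apply: (odd_size (x :: A)); last by rewrite sz !ltnS leq_addr.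
    by rewrite /odd_closed pA allx.
  apply: (odd_size (x :: B)); last by rewrite sz !ltnS leq_addl.
  by rewrite /odd_closed pB sgB allx.
(* There are no loops, and going along an edge and back has sign [w x y (+) w y x], which is
   even. *)
have sz3 : 2 < size q.
  case: (q) oq => [|x [|y [|z p]]] //; rewrite /odd_closed /= ?adj_irrefl //.
  by rewrite !addbF wC addbb !andbF.
split=> //.
  split; first by rewrite /is_cycle sz3 /ucycleb cq.
  move=> x y xq yq xy; case/rot_to: (xq) => n p Ep.
  have nxy : x != y by apply: contraTneq xy => ->; rewrite adj_irrefl.
  have yp : y \in p by move: yq; rewrite -(mem_rot n) Ep inE eq_sym (negPf nxy).
  have [A [B EAB]] : exists A B, p = A ++ y :: B by case/splitPr: yp => A B; exists A, B.
  have sz : size q = (size A + size B).+2.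
    by rewrite -(size_rot n) Ep EAB /= size_cat /= addnS.
  rewrite -(cycle_edge_rot n) // Ep EAB -[x :: _]cat0s cycle_edge_split; last first.
    by rewrite cat0s -EAB -Ep rot_uniq.
  rewrite andbT; apply/norP => -[A0 B0].
  rewrite EAB in Ep; have [pA pB sA sB sg] := split _ _ _ _ _ Ep.
  have sgr u C v : walk_sign u (rcons (rcons C v) u) = walk_sign u (rcons C v) (+) w v u.
    by rewrite -[in LHS]cats1 walk_sign_cat last_rcons /= addbF.
  have closed u C v : path (@adj G) u (rcons C v) -> adj v u -> {subset u :: rcons C v <= D} ->
      walk_sign u (rcons C v) (+) w v u -> odd_closed (u :: rcons C v).
    move=> pC vu sC sg'; apply/and3P; split; last by rewrite sgr.
      by rewrite rcons_path last_rcons pC.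
    exact/allP.
  (* The sign of the chord is added twice, once for each of the two closed walks that it cuts
     off. *)
  move: sg; rewrite -[walk_sign x _](addbK (w y x)) -addbA [_ (+) walk_sign y _]addbC {2}wC.
  case sg1: (walk_sign x (rcons A y) (+) w y x) => /= sg2.
    apply: (odd_size (x :: rcons A y)); first by apply: closed; rewrite // adj_sym.
    by rewrite sz /= size_rcons !ltnS -[X in X < _]addn0 ltn_add2l lt0n size_eq0; case: (B) B0.
  apply: (odd_size (y :: rcons B x)); first exact: closed.
  by rewrite sz /= size_rcons !ltnS -[X in X < _]add0n ltn_add2r lt0n size_eq0; case: (A) A0.
have -> : #|[set x in q | w x (next q x)]| = count (fun x => w x (next q x)) q.
  rewrite -size_filter -(card_uniqP (filter_uniq _ Uq)).
  by apply: eq_card => x; rewrite !inE mem_filter andbC.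
have walk f x p z : path (fun u v => f u == v) x (rcons p z) ->
    walk_sign x (rcons p z) = odd (count (fun u => w u (f u)) (x :: p)).
  elim: p x => [|y p IH] x /=; first by rewrite andbT => /eqP->; rewrite addbF addn0 oddb.
  by case/andP => /eqP-> /IH ->; rewrite [RHS]oddD oddb.
move: (cycle_next Uq) oq; move: (next q) => f; case: (q) => // x p cyc.
by case/and3P => _ _; rewrite (walk f).
Qed.

(** In the signed double cover [r], a path joining the two lifts of a vertex projects to an odd
    closed walk. If there is none, each component of [D] lifts to two sheets, and the sheet is the
    balancing. *)
Lemma balanced_or_odd_hole :
  (exists f : G -> bool, {in D &, forall x y, adj x y -> f x (+) f y = w x y}) \/
  (exists q, [/\ hole q, {subset q <= D} & odd #|[set x in q | w x (next q x)]|]).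
Proof.
pose r := [rel u v : G * bool | [&& u.1 \in D, v.1 \in D, adj u.1 v.1 &
                                   v.2 == u.2 (+) w u.1 v.1]].
have rC : symmetric r.
  move=> [x a] [y b] /=; rewrite andbCA; congr [&& _, _ & _]; rewrite adj_sym wC.
  by congr andb; apply/eqP/eqP => ->; rewrite addbK.
have cC := sym_connect_sym rC.
have walk x a (p : seq (G * bool)) b y : path r (x, a) p -> last (x, a) p = (y, b) ->
    [/\ path (@adj G) x (map fst p), all (mem D) (map fst p),
      last x (map fst p) = y & walk_sign x (map fst p) = a (+) b].
  elim: p x a => [|[z c] p IH] x a /=; first by move=> _ [-> ->]; rewrite addbb.
  case/andP => /and4P[/= xD zD xz /eqP->] /IH H /H[-> -> -> ->].
  by rewrite xz zD; split=> //; rewrite addbA [w x z (+) _]addbC addbK.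
have [/exists_inP[x xD]|/exists_inPn no] :=
    boolP [exists x in D, connect r (x, false) (x, true)].
  case/connectP => p /walk H /esym/H[pp pD lp sg]; right.
  have ex : exists n, [exists t : n.-tuple G, odd_closed t].
    move: pp pD lp sg; case/lastP: (map fst p) => [//|A y] + + + + .
    rewrite last_rcons => pA AD yx sg; rewrite yx in pA AD sg.
    exists (size (x :: A)); apply/existsP; exists (in_tuple (x :: A)).
    apply/and3P; split=> //; rewrite /= xD.
    by apply/allP => z zA; apply: (allP AD); rewrite mem_rcons inE zA orbT.
  case: (ex_minnP ex) => n /existsP[t ot] min_t; exists t; apply: odd_closed_hole => // q oq.
  by rewrite size_tuple; apply: min_t; apply/existsP; exists (in_tuple q).
left; pose r0 := [rel u v : G | [&& u \in D, v \in D & adj u v]].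
have r0C : connect_sym r0.
  by apply: sym_connect_sym => x y /=; rewrite andbCA adj_sym.
have lift x a y : connect r0 x y -> exists b, connect r (x, a) (y, b).
  case/connectP => p + ->; elim: p x a => [|z p IH] x a /=.
    by move=> _; exists a; apply: connect0.
  case/andP => xz pz; have [b cb] := IH z (a (+) w x z) pz; exists b; apply: connect_trans cb.
  by apply: connect1; rewrite /= eqxx andbT.
(* [f x] tells which lift of [x] lies in the sheet of [(root r0 x, false)]. *)
pose f x := connect r (root r0 x, false) (x, true).
have fE x b : x \in D -> connect r (root r0 x, false) (x, b) -> f x = b.
  move=> xD; case: b => // cx; apply/negP => fx; case/negP: (no x xD).
  by apply: connect_trans fx; rewrite cC.
exists f => x y xD yD xy.
have rxy : root r0 x = root r0 y.
  by apply/(rootP r0C)/connect1; rewrite /= xD yD.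
have [b cb] : exists b, connect r (root r0 x, false) (x, b).
  by apply: lift; rewrite r0C connect_root.
rewrite (fE x b) // (fE y (b (+) w x y)) ?addbA ?addbb // -rxy.
by apply: connect_trans cb (connect1 _); rewrite /= xD yD xy eqxx.
Qed.

End Balance.

(** * Triangle-free graphs *)

Section Colouring.

Variable G : sgraph.
Implicit Types (x y z s : G) (A K W D S : {set G}).

Definition proper_on (C : eqType) A (h : G -> C) :=
  {in A &, forall x y, adj x y -> h x != h y}.

Definition component A x :=
  [set y in A | connect [rel u v | [&& u \in A, v \in A & adj u v]] x y].

Lemma connect_inC A : connect_sym [rel u v | [&& u \in A, v \in A & @adj G u v]].
Proof. by apply: sym_connect_sym => x y /=; rewrite andbCA adj_sym. Qed.

Lemma component_connected A x : connected (component A x).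
Proof.
move=> u v uK; rewrite inE => /andP[vA xv].
have /connectP[p rp ->] : connect [rel u v | [&& u \in A, v \in A & adj u v]] u v.
  by apply: connect_trans xv; rewrite connect_inC; move: uK; rewrite inE => /andP[].
elim: p u rp uK => //= y p IH u /andP[/and3P[uA yA uy] /IH yp] uK.
have yK : y \in component A x.
  move: (uK); rewrite !inE yA /= => /andP[_ xu]; apply: connect_trans xu _.
  by apply: connect1; rewrite /= uA yA.
by apply: connect_trans (yp yK); apply: connect1; rewrite /= uK yK.
Qed.

Lemma component_closed A x u v :
  u \in component A x -> v \in A -> adj u v -> v \in component A x.
Proof.
rewrite !inE => /andP[uA xu] vA uv; rewrite vA; apply: connect_trans xu _.
by apply: connect1; rewrite /= uA vA.
Qed.

(** Every vertex of [A] uses the colouring chosen for its component, indexed by the root; [ok]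
    carries a constraint on each vertex through the gluing. *)
Lemma glue_components (C : eqType) A (ok : G -> C -> bool) : C ->
    (forall K, K \subset A -> connected K -> exists h : G -> C,
       proper_on K h /\ {in K, forall x, ok x (h x)}) ->
  exists h : G -> C, proper_on A h /\ {in A, forall x, ok x (h x)}.
Proof.
move=> c0 H; pose r := [rel u v : G | [&& u \in A, v \in A & adj u v]].
have rC : connect_sym r := connect_inC A.
have [g gP] : exists g : G -> G -> C, forall x,
    proper_on (component A x) (g x) /\ {in component A x, forall y, ok y (g x y)}.
  apply: (@fin_all_exists G (fun=> G -> C) (fun x g =>
    proper_on (component A x) g /\ {in component A x, forall y, ok y (g y)})) => x.
  apply: H; last exact: component_connected.
  by apply/subsetP => y; rewrite inE => /andP[].
have in_comp x : x \in A -> x \in component A (root r x).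
  by move=> xA; rewrite inE xA rC connect_root.
exists (fun x => g (root r x) x); split=> [x y xA yA xy|x xA]; last first.
  by apply: (gP _).2; apply: in_comp.
have rxy : root r x = root r y by apply/(rootP rC)/connect1; rewrite /= xA yA.
by rewrite -rxy; apply: (gP _).1; rewrite ?in_comp // rxy in_comp.
Qed.

(** The two other colours are indexed by [bool] so as to be composed with a balancing. *)
Lemma other_colours (c : 'I_3) : exists ct : bool -> 'I_3, injective ct /\ forall b, ct b != c.
Proof.
exists (fun b => if b then inord (c.+1 %% 3) else inord (c.+2 %% 3)).
by case: c => -[|[|[|]]] //= ?; split=> [[] [] // /(congr1 val)|[]]; rewrite -?val_eqE /= !inordK.
Qed.

Lemma connected_const (T : Type) (f : G -> T) K : connected K ->
  {in K &, forall x y, adj x y -> f x = f y} -> {in K &, forall x y, f x = f y}.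
Proof.
move=> cK fK x y xK yK; have /connectP[p rp ->] := cK _ _ xK yK.
elim: p x xK rp => //= z p IH x xK /andP[/and3P[_ zK xz] rp].
by rewrite (fK x z) //; apply: IH.
Qed.

Hypotheses (hG : unique_chord_free G) (tfG : triangle_free G).

Definition touched W x :=
  [exists s, [&& s \notin W, [exists u in W, adj s u] & adj s x]].

(* For [x] in [D], the neighbour of [x] witnessing [touched W x] lies outside [D],
   as [W] sends no edge to [D]; [c] is the colour meant for all such neighbours. *)
Lemma three_colouring_avoiding W D (c : 'I_3) :
    connected W -> connected D -> {in W, forall u, u \notin D} ->
    {in W & D, forall u d, ~~ adj u d} ->
  exists h : G -> 'I_3, proper_on D h /\ {in D, forall x, touched W x -> h x != c}.
Proof.
have [n] := ubnP #|D|; elim: n W D c => // n IH W D c lt_Dn cW cD WD nWD.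
have [ct [ctI ctc]] := other_colours c.
pose S := [set s | [&& s \notin W, [exists u in W, adj s u] & [exists d in D, adj s d]]].
pose T := [set x in D | attached S x].
have SW : {in S, forall s, s \notin W} by move=> s; rewrite inE => /and3P[].
have aSW : {in S, forall s, exists2 u, u \in W & adj s u}.
  by move=> s; rewrite inE => /and3P[_ /exists_inP].
have aSD : {in S, forall s, exists2 d, d \in D & adj s d}.
  by move=> s; rewrite inE => /and3P[_ _ /exists_inP].
have SD : {in S, forall s, s \notin D}.
  move=> s /aSW[u uW su]; apply/negP => sD.
  by have := nWD _ _ uW sD; rewrite adj_sym su.
have sS : {in S &, forall s s', ~~ adj s s'}.
  move=> s s' sS1 s'S; apply: (connected_attach_stable hG cW cD WD nWD);
    solve [exact: SW | exact: SD | exact: aSW | exact: aSD].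
have touchedT x : x \in D -> touched W x -> x \in T.
  move=> xD /existsP[s /and3P[sW su sx]]; rewrite inE xD; apply/exists_inP; exists s => //.
  by rewrite inE sW su; apply/exists_inP; exists x.
(* If [T] is empty, removing it does not shrink [D]. Instead a vertex [u] gets [ct true], its
   neighbours get [c], and the induction hypothesis with [[set u]] in place of [W] colours the
   rest. *)
have [T0|[t tT]] := set_0Vmem T.
  have [D0|[u uD]] := set_0Vmem D.
    by exists (fun=> c); split=> [x y|x]; rewrite D0 inE.
  pose A := [set x in D | (x != u) && ~~ adj u x].
  have ltA K : {subset K <= A} -> #|K| < n.
    move=> KA; rewrite -ltnS; apply: leq_trans lt_Dn; rewrite ltnS.
    apply/proper_card/properP; split.
      by apply/subsetP => x /KA; rewrite inE => /andP[].
    by exists u => //; apply/negP => /KA; rewrite !inE eqxx andbF.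
  have [h [hA hc]] : exists h : G -> 'I_3, proper_on A h /\
      {in A, forall x, touched [set u] x ==> (h x != c)}.
    apply: (@glue_components _ _ (fun x col => touched [set u] x ==> (col != c)) c).
    move=> K /subsetP KA cK; have [|||h [hK hc]] := IH [set u] K c (ltA K KA) _ cK.
    - by move=> x y; rewrite !inE => /eqP-> /eqP->; apply: connect0.
    - by move=> x; rewrite inE => /eqP->; apply/negP => /KA; rewrite !inE eqxx andbF.
    - by move=> x y; rewrite inE => /eqP-> /KA; rewrite inE => /and3P[].
    - by exists h; split=> // x xK; apply/implyP; apply: hc.
  exists (fun x => if x == u then ct true else if adj u x then c else h x); split; last first.
    by move=> x xD /(touchedT x xD); rewrite T0 inE.
  move=> x y xD yD xy; have yx : adj y x by rewrite adj_sym.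
  (* A vertex [b] of the rest adjacent to a neighbour [a] of [u] is touched by [[set u]] through
     [a], so it avoids [c]. *)
  have touch a b : b \in D -> adj u a -> adj a b -> b != u -> ~~ adj u b -> h b != c.
    move=> bD ua ab bu ub; have bA : b \in A by rewrite inE bD bu.
    apply: (implyP (hc _ bA)); apply/existsP; exists a; rewrite ab andbT inE.
    rewrite (contraTneq _ ua) => [|->]; last by rewrite adj_irrefl.
    by apply/exists_inP; exists u; rewrite ?inE // adj_sym.
  case: (eqVneq x u) xy yx => [->|xu] xy yx.
    by case: (eqVneq y u) xy => [->|yu ->]; rewrite ?adj_irrefl // ctc.
  case: (eqVneq y u) xy yx => [->|yu] xy yx; first by rewrite yx eq_sym.
  have [ux|ux] := boolP (adj u x); have [uy|uy] := boolP (adj u y).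
  - by have := tfG ux xy; rewrite uy.
  - by rewrite eq_sym; apply: (touch x).
  - by apply: (touch y).
  - by apply: hA; rewrite // inE ?xD ?yD ?xu ?yu.
(* The negative edges are those inside [T], and [hole_even_attached] excludes a hole with an odd
   number of them. *)
pose w x y := attached S x && attached S y.
have wC : symmetric w by move=> x y; rewrite /w andbC.
have [[f fP]|[q [hq qD]]] := balanced_or_odd_hole D wC; last first.
  by rewrite (negPf (hole_even_attached hG tfG cW WD nWD SW SD sS aSW hq qD)).
pose A := D :\: T.
have AD x : x \in A -> x \in D by rewrite inE => /andP[].
have AT x : x \in A -> attached S x = false.
  by rewrite !inE => /andP[+ xD]; rewrite xD => /negPf.
(* Edges with an end outside [T] are positive, so [f] is constant on each component of [A] together
   with its neighbours in [T]. *)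
have fA : {in D &, forall x y, x \in A -> adj x y -> f x = f y}.
  move=> x y xD yD xA xy; have := fP x y xD yD xy; rewrite /w AT //=.
  by case: (f x); case: (f y).
have ltA K : {subset K <= A} -> #|K| < n.
  move=> KA; rewrite -ltnS; apply: leq_trans lt_Dn; rewrite ltnS; apply/proper_card/properP; split.
    by apply/subsetP => x /KA /AD.
  exists t; first by move: tT; rewrite inE => /andP[].
  by apply/negP => /KA; rewrite inE tT.
have cWS : connected (W :|: S).
  pose r := [rel u v : G | [&& u \in W :|: S, v \in W :|: S & adj u v]].
  have rC : connect_sym r := connect_inC _.
  have cWr : {in W &, forall x y, connect r x y}.
    move=> x y xW yW; apply: connect_sub (cW x y xW yW) => a b /and3P[aW bW ab].
    by apply: connect1; rewrite /= !in_setU aW bW.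
  have toW x : x \in W :|: S -> exists2 y, y \in W & connect r x y.
    case/setUP => [xW|xS]; first by exists x => //; apply: connect0.
    have [y yW xy] := aSW x xS; exists y => //; apply: connect1.
    by rewrite /= !in_setU xS yW orbT.
  move=> x y /toW[x' x'W xx'] /toW[y' y'W yy'].
  by apply: connect_trans xx' (connect_trans (cWr _ _ x'W y'W) _); rewrite rC.
pose ok x (col : 'I_3) := [forall y in T, adj x y ==> (col != ct (f y))].
have [h [hA hok]] : exists h : G -> 'I_3, proper_on A h /\ {in A, forall x, ok x (h x)}.
  (* All neighbours in [T] of the component [K] get the colour [ct (f k)], so this is the colour to
     avoid. *)
  apply: (@glue_components _ _ ok c) => K /subsetP KA cK.
  have [K0|[k kK]] := set_0Vmem K.
    by exists (fun=> c); split=> [x y|x]; rewrite K0 inE.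
  have [||h [hK hc]] := IH (W :|: S) K (ct (f k)) (ltA K KA) cWS cK.
  - by move=> x /setUP[/WD|/SD]; apply: contra => /KA /AD.
  - move=> x y /setUP[xW|xS] yK; first by apply: nWD => //; apply/AD/KA.
    apply/negP => xy; have /negbT/negP[] := AT y (KA y yK).
    by apply/exists_inP; exists x.
  exists h; split=> // x xK; apply/forall_inP => y yT; apply/implyP => xy.
  have /setIdP[yD /exists_inP[s sS1 sy]] := yT.
  have xA := KA x xK; have xD := AD x xA.
  rewrite -(fA x y) // (connected_const cK (f := f) _ xK kK); last first.
    by move=> a b aK bK; apply: fA; rewrite ?AD ?KA.
  (* [y] is outside [W :|: S] and adjacent to both [s] and [x], hence witnesses that [x] is
     touched. *)
  apply: hc => //; apply/existsP; exists y; rewrite [adj y x]adj_sym xy andbT.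
  apply/andP; split; last by apply/exists_inP; exists s; rewrite ?in_setU ?sS1 ?orbT // adj_sym.
  by apply/negP => /setUP[/WD|/SD]; rewrite yD.
exists (fun x => if x \in T then ct (f x) else h x); split; last first.
  by move=> x xD /(touchedT x xD) ->.
move=> x y xD yD xy.
have [xT|xT] := boolP (x \in T); have [yT|yT] := boolP (y \in T).
- apply/eqP => /ctI E; have := fP x y xD yD xy; rewrite E addbb /w.
  by move: xT yT; rewrite !inE => /andP[_ ->] /andP[_ ->].
- rewrite eq_sym; have yA : y \in A by rewrite inE yT.
  by apply: (implyP (forall_inP (hok y yA) x xT)); rewrite adj_sym.
- have xA : x \in A by rewrite inE xT.
  exact: (implyP (forall_inP (hok x xA) y yT)).
- by apply: hA; rewrite // inE ?xT ?yT.
Qed.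

(** With [W] empty nothing is touched, so the avoided colour [ord0] is arbitrary. *)
Lemma triangle_free_three_colouring : exists h : G -> 'I_3, proper_on setT h.
Proof.
have [h [hP _]] : exists h : G -> 'I_3, proper_on setT h /\ {in [set: G], forall x, true}.
  apply: (@glue_components _ _ (fun _ _ => true) ord0) => K _ cK.
  have [|||h [hK _]] := @three_colouring_avoiding set0 K ord0 _ cK.
  - by move=> x; rewrite inE.
  - by move=> x; rewrite inE.
  - by move=> x y; rewrite inE.
  - by exists h.
by exists h.
Qed.

End Colouring.

(** * Triangles *)

Section Restriction.

Variables (G : sgraph) (U : {set G}).

(** All vertices are kept and only the edges not inside [U] are dropped, so that colourings and
    sequences keep their type. *)
Definition adj_in : rel G := [rel x y | [&& x \in U, y \in U & adj x y]].

Lemma adj_in_sym : symmetric adj_in.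
Proof. by move=> x y; rewrite /adj_in /= andbCA adj_sym. Qed.

Lemma adj_in_irrefl : irreflexive adj_in.
Proof. by move=> x; rewrite /adj_in /= adj_irrefl !andbF. Qed.

Definition restriction := SGraph adj_in_sym adj_in_irrefl.

(** A cycle of the restriction lies in [U], where adjacency is unchanged, so it has the same chords
    in [G]. *)
Lemma restriction_unique_chord_free :
  unique_chord_free G -> unique_chord_free restriction.
Proof.
move=> hG c /andP[sc /andP[cc uc]].
have cU : {subset c <= U} by move=> x /(next_cycle cc) /and3P[].
have cG : @is_cycle G c.
  by rewrite /is_cycle sc /ucycleb uc andbT (sub_cycle _ cc) // => x y /and3P[].
suff <- : @chords G c = @chords restriction c by apply: hG.
have adjE x y : x \in c -> y \in c -> @adj restriction x y = @adj G x y.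
  by move=> /cU xU /cU yU; rewrite /= /adj_in /= xU yU.
by apply/setP => Z; apply/imsetP/imsetP => -[p];
  rewrite inE => /and4P[p1 p2 e n] ->; exists p => //;
  rewrite inE; apply/and4P; split=> //; [rewrite adjE | rewrite -adjE].
Qed.

End Restriction.

Section Main.

Variable G : sgraph.
Implicit Types (x y z : G) (K U C : {set G}).

Lemma cliqueP K : reflect {in K &, forall x y, x != y -> adj x y} (clique K).
Proof.
apply: (iffP forall_inP) => [H x y xK yK xy|H x xK].
  by apply: (implyP (forall_inP (H x xK) y yK)).
by apply/forall_inP => y yK; apply/implyP; apply: H.
Qed.

Hypothesis hG : unique_chord_free G.

Section Clique.

Variables U K : {set G}.
Hypotheses (Kcl : clique K) (KU : K \subset U) (K3 : 2 < #|K|).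
Hypothesis Kmax : forall v, v \in U -> v \notin K -> exists2 z, z \in K & ~~ adj v z.

(** If [x] and [y] differ and [z] in [K] is not adjacent to [v], the cycle [x v y z] has the unique
    chord [x y]. *)
Lemma clique_one_neighbour v x y : v \in U -> v \notin K -> x \in K -> y \in K ->
  adj x v -> adj y v -> x = y.
Proof.
move=> vU vK xK yK xv yv; apply/eqP/negPn/negP => nxy.
have [z zK vz] := Kmax vU vK.
have zx : z != x by apply: contraNneq vz => ->; rewrite adj_sym.
have zy : z != y by apply: contraNneq vz => ->; rewrite adj_sym.
have adjK := cliqueP K Kcl.
have vN u : u \in K -> v != u by move=> uK; apply: contraNneq vK => ->.
apply: (@no_ladder _ hG x [:: v] z [:: y]).
- apply: induced_path_cons => //; last exact: induced_path1.
  by rewrite inE eq_sym vN.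
- apply: induced_path_cons => //; [by rewrite inE | exact: adjK | exact: induced_path1].
- by move=> u; rewrite !inE => /orP[]/eqP->; rewrite negb_or ?vN // eq_sym zx.
- by apply: adjK; rewrite // eq_sym.
- by rewrite /= adj_sym.
rewrite !cut_edges_cons /cut_edges big_nil /= (negPf vz) (adj_sym v) yv.
by rewrite !adjK // eq_sym.
Qed.

(** Take a shortest path in [C] from a neighbour of [x] to a neighbour of some other [y'] in [K]. A
    third vertex [z] of [K] has no neighbour on it, so [x], the path, [y'] and [z] form a cycle with
    the unique chord [x y']. *)
Lemma clique_one_attachment C x y c d : connected C -> C \subset U :\: K ->
  x \in K -> y \in K -> c \in C -> d \in C -> adj x c -> adj y d -> x = y.
Proof.
move=> cC CU xK yK cin din xc yd; apply/eqP/negPn/negP => nxy.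
have adjK := cliqueP K Kcl.
pose Q v := [exists u in K, (u != x) && adj u v].
have Qd : Q d by apply/exists_inP; exists y; rewrite // eq_sym nxy.
have [a [A [IA AC Ax AQ]]] := shortest_path cC cin din xc Qd.
have AUK u : u \in a :: A -> u \in U /\ u \notin K.
  by move=> /AC /(subsetP CU); rewrite inE => /andP[].
have /exists_inP[y' y'K /andP[y'x y'l]] : Q (last a A) by rewrite AQ ?mem_last.
have [z zK /andP[zx zy]] : exists2 z, z \in K & (z != x) && (z != y').
  have : 0 < #|K :\ x :\ y'|.
    move: K3; rewrite (cardsD1 x) xK (cardsD1 y' (K :\ x)) !inE y'x y'K.
    by rewrite !add1n !ltnS.
  by case/card_gt0P => z; rewrite !inE => /and3P[? ? ?]; exists z => //; apply/andP.
have [lU lK] := AUK _ (mem_last a A).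
have Az : {in a :: A, forall u, adj z u = false}.
  move=> u uA; apply/negP => zu; have : Q u by apply/exists_inP; exists z; rewrite ?zx.
  rewrite AQ // => /eqP E; rewrite E in zu.
  by have := clique_one_neighbour lU lK zK y'K zu y'l; move/eqP: zy.
have Ay : {in a :: A, forall u, adj y' u = (u == last a A)}.
  move=> u uA; apply/idP/eqP => [y'u|-> //]; apply/eqP; rewrite -AQ //.
  by apply/exists_inP; exists y'; rewrite ?y'x.
have nA u v : u \in K -> v \in a :: A -> v != u.
  by move=> uK /AUK[_]; apply: contraNneq => ->.
apply: (@no_ladder _ hG x (a :: A) z [:: y']).
- apply: induced_path_cons => //.
  + by apply/negP => /(nA _ _ xK); rewrite eqxx.
  + by rewrite Ax ?mem_head.
  + move=> u uA; rewrite Ax ?inE ?uA ?orbT //; case: IA => /= /andP[/negP aA _] _ _.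
    by apply/eqP => E; case: aA; rewrite -E.
- apply: induced_path_cons => //; [by rewrite inE | exact: adjK | exact: induced_path1].
- move=> u; rewrite inE => /predU1P[->|uA]; last by rewrite !inE negb_or !nA.
  by rewrite !inE negb_or !(eq_sym x) zx.
- by apply: adjK; rewrite // eq_sym.
- by rewrite /= adj_sym.
rewrite cut_edges_cons cut_edgesC !cut_edges_cons /cut_edges big_nil.
rewrite (eq_in_count Az) count_pred0 (count_single _ (mem_last a A) Ay); last by case: IA.
by rewrite /= !adjK // eq_sym.
Qed.

End Clique.

(** If [U] contains a triangle, extend it to a maximal clique [K] of [U]. A component [C] of the
    rest meets [K] through at most one vertex [a], so colourings of [U :\: C] and [a |: C] can be
    glued at [a]. Otherwise three colours suffice. *)
Lemma colouring_on k U : 2 < k -> (forall K, clique K -> #|K| <= k) ->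
  exists h : G -> 'I_k, proper_on U h.
Proof.
move=> k3 kcl; have [n] := ubnP #|U|; elim: n U => // n IH U lt_Un.
have [/existsP[x /existsP[y /existsP[z]]]|noT] := boolP [exists x, exists y, exists z,
    [&& x \in U, y \in U, z \in U, adj x y, adj y z & adj x z]].
  case/and5P => xU yU zU xy /andP[yz xz].
  pose P A := clique A && (A \subset U).
  have P0 : P [set x; y; z].
    apply/andP; split; last by apply/subsetP => u; rewrite !inE => /orP[/orP[]|]/eqP->.
    apply/cliqueP => u v; rewrite !inE => /orP[/orP[]|]/eqP-> /orP[/orP[]|]/eqP->;
      by rewrite ?eqxx // adj_sym.
  have [K /maxsetP[/andP[Kcl KU] Kmax] sK] := maxset_exists P0.
  have K3 : 2 < #|K|.
    apply: leq_trans (subset_leq_card sK); rewrite -setUA cardsU1 !inE negb_or cards2.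
    have ne u v : adj u v -> u != v by apply: contraTneq => ->; rewrite adj_irrefl.
    by rewrite !ne.
  have K1 v : v \in U -> v \notin K -> exists2 z, z \in K & ~~ adj v z.
    move=> vU vK; apply/exists_inP; rewrite -negb_forall_in; apply: contra vK => /forall_inP vadj.
    rewrite -(Kmax (v |: K)) ?subsetUr ?setU11 //; apply/andP; split; last first.
      by apply/subsetP => u /setU1P[->|/(subsetP KU)].
    apply/cliqueP => a b /setU1P[->|aK] /setU1P[->|bK]; rewrite ?eqxx //.
    - by move=> _; apply: vadj.
    - by move=> _; rewrite adj_sym; apply: vadj.
    - exact: (cliqueP _ Kcl).
  have [UK|[v vUK]] := set_0Vmem (U :\: K).
    have xK : x \in K by apply: (subsetP sK); rewrite !inE eqxx.
    have inK u : u \in U -> u \in K.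
      by move=> uU; apply: contraT => uK; have := in_set0 u; rewrite -UK inE uK uU.
    exists (fun u => widen_ord (kcl K Kcl) (enum_rank_in xK u)) => u v /inK uK /inK vK.
    apply: contraTneq => /(congr1 val)/= /val_inj /(enum_rank_in_inj uK vK) ->.
    by rewrite adj_irrefl.
  pose C := component (U :\: K) v.
  have CU : C \subset U :\: K by apply/subsetP => u; rewrite inE => /andP[].
  have vC : v \in C by rewrite inE vUK connect0.
  have cC : connected C by apply: component_connected.
  have [a aK attach] : exists2 a, a \in K & forall y c, y \in K -> c \in C -> adj y c -> y = a.
    have [/existsP[a /existsP[c /and3P[aK cC' ac]]]|no] :=
        boolP [exists a, exists c, [&& a \in K, c \in C & adj a c]].
      exists a => // u d uK dC ud.
      exact: (clique_one_attachment Kcl K3 K1 cC CU uK aK dC cC' ud ac).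
    (* With no edge between [K] and [C], any vertex of [K] can serve as [a]. *)
    exists x; first by apply: (subsetP sK); rewrite !inE eqxx.
    move=> u d uK dC ud; case/negP: no; apply/existsP; exists u.
    by apply/existsP; exists d; rewrite uK dC.
  have aC : a \notin C by apply/negP => /(subsetP CU); rewrite inE aK.
  (* The vertex [b] shows that [a |: C] is a proper subset of [U]. *)
  have [b bK ba] : exists2 b, b \in K & b != a.
    have : 0 < #|K :\ a| by move: K3; rewrite (cardsD1 a K) aK => /ltnW.
    by case/card_gt0P => b; rewrite !inE => /andP[? ?]; exists b.
  have [|h1 h1P] := IH (U :\: C).
    rewrite -ltnS; apply: leq_trans lt_Un; rewrite ltnS; apply/proper_card/properP.
    split; first exact: subsetDl.
    by exists v; [move: vUK; rewrite inE => /andP[] | rewrite inE vC].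
  have [|h2 h2P] := IH (a |: C).
    rewrite -ltnS; apply: leq_trans lt_Un; rewrite ltnS; apply/proper_card/properP.
    split; last first.
      exists b; first exact: (subsetP KU).
      rewrite in_setU1 negb_or ba; apply/negP => /(subsetP CU).
      by rewrite inE bK.
    apply/subsetP => u /setU1P[->|/(subsetP CU)]; first exact: (subsetP KU).
    by rewrite inE => /andP[].
  (* Exchanging two colours on [C] makes the two colourings agree at [a]. *)
  pose t := tperm (h2 a) (h1 a).
  exists (fun u => if u \in C then t (h2 u) else h1 u).
  have aux u w : u \in C -> w \in U -> w \notin C -> adj u w -> t (h2 u) != h1 w.
    move=> uC wU wC uw; have wK : w \in K.
      apply: contraNT wC => wK; apply: component_closed uC _ uw.
      by rewrite inE wK.
    have wa : w = a by apply: attach wK uC _; rewrite adj_sym.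
    rewrite wa -[h1 a](tpermL (h2 a) (h1 a)) (inj_eq perm_inj); apply: h2P.
    - by rewrite in_setU1 uC orbT.
    - exact: setU11.
    - by rewrite -wa.
  move=> u w uU wU uw; case: ifPn => uC; case: ifPn => wC.
  - by rewrite (inj_eq perm_inj); apply: h2P; rewrite ?in_setU1 ?uC ?wC ?orbT.
  - exact: aux.
  - by rewrite eq_sym; apply: aux; rewrite // adj_sym.
  - by apply: h1P; rewrite // in_setD ?uC ?wC.
have tf : triangle_free (restriction U).
  move=> x y z /and3P[xU yU xy] /and3P[_ zU yz]; apply/negP => /and3P[_ _ xz].
  case/negP: noT; apply/existsP; exists x; apply/existsP; exists y; apply/existsP; exists z.
  by rewrite xU yU zU xy yz xz.
have [h hP] := triangle_free_three_colouring (@restriction_unique_chord_free G U hG) tf.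
exists (fun x => widen_ord k3 (h x)) => x y xU yU xy.
have := hP x y; rewrite !inE /= /adj_in /= xU yU => /(_ isT isT xy).
by apply: contra => /eqP/(congr1 val)/= E; apply/eqP/val_inj.
Qed.

(** * Chromatic number and clique number *)

Lemma colorableP k : reflect (exists h : G -> 'I_k, proper_on setT h) (colorable G k).
Proof.
apply: (iffP existsP) => -[h hP].
  by exists h => x y _ _ xy; move/'forall_forallP: hP => /(_ x y)/implyP; apply.
exists [ffun x => h x]; apply/'forall_forallP => x y; apply/implyP => xy.
by rewrite !ffunE; apply: hP; rewrite ?inE.
Qed.

Lemma chi_le k : (exists h : G -> 'I_k, proper_on setT h) -> chi G <= k.
Proof. by move/colorableP; rewrite /chi; case: ex_minnP => m _ H /H. Qed.

Lemma omega_le_chi : omega G <= chi G.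
Proof.
rewrite /chi; case: ex_minnP => m /colorableP[h hP] _.
apply/bigmax_leqP => K /cliqueP Kcl; rewrite -[m]card_ord -(card_in_imset (f := h)) ?max_card //.
move=> x y xK yK; apply: contra_eq => xy.
by apply: hP; rewrite ?inE //; apply: Kcl.
Qed.

Lemma clique_le_omega K : clique K -> #|K| <= omega G.
Proof. by move=> Kcl; apply: (leq_bigmax_cond (F := fun A : {set G} => #|A|)). Qed.

End Main.

Theorem theorem6p5 (G : sgraph) (hG : unique_chord_free G) :
  (chi G = omega G \/ chi G <= 3) /\ chi G <= omega G + 1.
Proof.
have bound k : 2 < k -> omega G <= k -> chi G <= k.
  move=> k3 ok; apply/chi_le/(colouring_on hG) => // K /clique_le_omega.
  by move/leq_trans; apply.
have [w3|w2] := leqP 3 (omega G).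
  have E : chi G = omega G by apply/eqP; rewrite eqn_leq omega_le_chi bound.
  by split; [left | rewrite E leq_addr].
have c3 : chi G <= 3 by apply: bound => //; apply: ltnW.
split; first by right.
have [w1|w1] := leqP 2 (omega G); first by apply: leq_trans c3 _; rewrite addn1 ltnS.
(* When the clique number is at most one there is no edge, and one colour suffices. *)
apply: (@leq_trans 1); last by rewrite addn1.
apply: chi_le; exists (fun=> ord0) => x y _ _ xy; exfalso.
have nxy : x != y by apply: contraTneq xy => ->; rewrite adj_irrefl.
have /clique_le_omega : clique [set x; y].
  apply/cliqueP => u v; rewrite !inE => /orP[]/eqP-> /orP[]/eqP->; rewrite ?eqxx //.
  by rewrite adj_sym.
by rewrite cards2 nxy leqNgt w1.
Qed.
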